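(* Let $m\ge 1$ be an integer, let $\mu>0$, and let $A$ be a probability distribution function of a nonnegative random variable with finite positive mean $1/\lambda$. Put $\varrho=\lambda/(m\mu)$ and $\alpha(s)=\int_0^\infty e^{-sx}\,dA(x)$. For each integer $n\ge 0$ let $p_{m,n}$ be the stationary loss probability of the $GI/M/m/n$ queueing system with interarrival time distribution $A$ and service rate $\mu$. Let $$\varrho_k=\int_0^\infty(\mu m x)^k\,dA(x),\qquad k=2,3.$$ Then the following hold. (i) If $\varrho>1$, then $$\lim_{n\to\infty}p_{m,n}=\frac{\varrho-1}{\varrho}.$$ (ii) If $\varrho=1$ and $\varrho_2<\infty$, then $$\lim_{n\to\infty}n\,p_{m,n}=\frac{\varrho_2}{2}.$$ (iii) If $\varrho=1$ and $\varrho_3<\infty$, then, as $n\to\infty$, $$p_{m,n}=\frac{\varrho_2}{2n}+O\Big(\frac{\log n}{n^2}\Big).$$ (iv) If $\varrho<1$, then $$\lim_{n\to\infty}\frac{p_{m,n}}{\sigma_m^n}=K_m\big[1+\mu m\,\alpha'(\mu m-\mu m\sigma_m)\big],$$ where $\alpha'$ is the derivative of $\alpha$, $\sigma_m$ is the least in absolute value root of the functional equation $z=\alpha(\mu m-\mu m z)$ (with $z$ real), and $$K_m=\Big[1+(1-\sigma_m)\sum_{j=1}^m\frac{\binom{m}{j}C_j}{1-\varphi_j}\cdot\frac{m(1-\varphi_j)-j}{m(1-\sigma_m)-j}\Big]^{-1},$$ $$\varphi_j=\int_0^\infty e^{-\mu j x}\,dA(x),\qquad C_j=\prod_{i=1}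^j\frac{1-\varphi_i}{\varphi_i}.$$
   Context: The $GI/M/m/n$ queueing system has $m$ identical servers and $n$ waiting places (so at most $m+n$ customers can be present). Customers arrive one at a time; interarrival times are independent with common distribution function $A$, of mean $1/\lambda$. Service times are independent, exponentially distributed with rate $\mu$, and independent of the arrivals. An arriving customer who finds all $m$ servers busy and all $n$ waiting places occupied is lost. The load is $\varrho=\lambda/(m\mu)$. The stationary loss probability $p_{m,n}$ is the stationary probability that an arriving customer is lost, i.e. the mass at state $m+n$ of the stationary distribution of the Markov chain on $\{0,1,\dots,m+n\}$ recording the number of customers in the system immediately before successive arrivals. (From state $i$, the chain moves as follows: after the arrival the number present is $\min(i+1,m+n)$; then, during an independent interarrival time with distribution $A$, the number present evolves as a pure death process with death rate $\mu\min(k,m)$ when $k$ customers are present.) Equivalently, $1/p_{m,n}$ is the expected number of arrivals between consecutive losses in the stationary regime. When $\varrho<1$ the root $\sigma_m$ belongs to the open interval $(0,1)$.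
   Formalization: In K_m, when m(1-σ_m)=j for some j<m (e.g. M/M/2 with ϱ=1/2) the quotient (m(1-φ_j)-j)/(m(1-σ_m)-j) is 0/0 and is read as its limiting value 1+μmα'(μj); otherwise the formula is unchanged. *)

(* Defs.v *)
From mathcomp Require Import all_boot all_order all_algebra.
From mathcomp Require Import all_classical all_reals all_analysis.
Set Implicit Arguments.
Unset Strict Implicit.
Unset Printing Implicit Defensive.
Import Order.TTheory GRing.Theory Num.Theory.
Import numFieldNormedType.Exports.
Local Open Scope classical_set_scope.
Local Open Scope ring_scope.

(* An interarrival distribution function: right-continuous, nondecreasing,
   with limits 0 and 1 (this is [cumulativeBounded 0 1]), vanishing on the
   negative reals. *)
Definition nonneg_cdf (R : realType) (A : cumulativeBounded (0 : R) (1 : R)) :=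
  forall x : R, x < 0 -> A x = 0.

(* Integrals [\int_0^oo g dA] are over [0, +oo[: a possible atom of A at 0 is
   included. *)
Definition intA (R : realType) (A : cumulativeBounded (0 : R) (1 : R))
    (g : R -> R) : \bar R :=
  (\int[lebesgue_stieltjes_measure A]_(x in `[0%R, +oo[) (g x)%:E)%E.

(* Extended-real valued, because the integral may diverge when s < 0. *)
Definition laplace (R : realType) (A : cumulativeBounded (0 : R) (1 : R))
    (s : R) : \bar R :=
  intA A (fun x => expR (- s * x)).

Definition alpha (R : realType) (A : cumulativeBounded (0 : R) (1 : R))
    (s : R) : R :=
  fine (laplace A s).

(* [death_prob rate k j t] is the probability that a pure death process with
   death rates [rate], started from k, is in j at time t, by conditioning on
   the exponential holding time s in k, after which the process is in k - 1.
   State 0 is absorbing. *)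
Fixpoint death_prob (R : realType) (rate : nat -> R) (k j : nat) (t : R) : R :=
  match k with
  | 0%N => (j == 0%N)%:R
  | k'.+1 =>
      if j == k then expR (- rate k * t)
      else \int[lebesgue_measure]_(s in `[0, t])
             (rate k * expR (- rate k * s) * death_prob rate k' j (t - s))
  end.

(* With k customers present, min(k, m) servers are busy. *)
Definition service_rate (R : realType) (mu : R) (m k : nat) : R :=
  mu * (minn k m)%:R.

Definition transition_mx (R : realType)
    (A : cumulativeBounded (0 : R) (1 : R)) (mu : R) (m n : nat) :
    'M[R]_((m + n).+1) :=
  \matrix_(i < (m + n).+1, j < (m + n).+1)
    fine (intA A (death_prob (service_rate mu m) (minn i.+1 (m + n)) j)).

Definition stationary (R : realType) (N : nat) (P : 'M[R]_N) (pi : 'rV[R]_N) :=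
  [/\ forall i, 0 <= pi 0 i, \sum_i pi 0 i = 1 & pi *m P = pi].

Definition is_loss_probability (R : realType)
    (A : cumulativeBounded (0 : R) (1 : R)) (mu : R) (m n : nat) (p : R) :=
  exists2 pi : 'rV[R]_((m + n).+1),
    stationary (transition_mx A mu m n) pi & p = pi 0 ord_max.

Definition load (R : realType) (lambda mu : R) (m : nat) : R :=
  lambda / (m%:R * mu).

(* The moments rho_2 and rho_3; the load is not [rho_ A mu m 1]. *)
Definition rho_ (R : realType) (A : cumulativeBounded (0 : R) (1 : R))
    (mu : R) (m k : nat) : \bar R :=
  intA A (fun x => (mu * m%:R * x) ^+ k).

Definition is_root (R : realType) (A : cumulativeBounded (0 : R) (1 : R))
    (mu : R) (m : nat) (z : R) :=
  z%:E = laplace A (mu * m%:R - mu * m%:R * z).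

Definition least_abs_root (R : realType)
    (A : cumulativeBounded (0 : R) (1 : R)) (mu : R) (m : nat) (sigma : R) :=
  is_root A mu m sigma /\
  forall z : R, is_root A mu m z -> `|sigma| <= `|z|.

Definition phi (R : realType) (A : cumulativeBounded (0 : R) (1 : R))
    (mu : R) (j : nat) : R :=
  alpha A (mu * j%:R).

Definition Cj (R : realType) (A : cumulativeBounded (0 : R) (1 : R))
    (mu : R) (j : nat) : R :=
  \prod_(1 <= i < j.+1) ((1 - phi A mu i) / phi A mu i).

(* The factor (m (1 - phi_j) - j) / (m (1 - sigma) - j). When
   m (1 - sigma) = j and sigma is a root, phi_j = sigma, so the quotient reads
   0 / 0. Writing a = mu m (1 - sigma) and b = mu j, it equals
   1 + mu m (alpha b - alpha a) / (b - a) for b <> a, so the singularity is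
   removable, with value 1 + mu m alpha'(mu j). *)
Definition K_ratio (R : realType) (A : cumulativeBounded (0 : R) (1 : R))
    (mu : R) (m : nat) (sigma : R) (j : nat) : R :=
  if m%:R * (1 - sigma) - j%:R == 0
  then 1 + mu * m%:R * derive1 (alpha A) (mu * j%:R)
  else (m%:R * (1 - phi A mu j) - j%:R) / (m%:R * (1 - sigma) - j%:R).

Definition K_ (R : realType) (A : cumulativeBounded (0 : R) (1 : R))
    (mu : R) (m : nat) (sigma : R) : R :=
  (1 + (1 - sigma) *
     \sum_(1 <= j < m.+1)
       ('C(m, j)%:R * Cj A mu j / (1 - phi A mu j) *
        K_ratio A mu m sigma j))^-1.

(* Main.v *)
Require Import Defs.
From mathcomp Require Import all_boot all_order all_algebra.
From mathcomp Require Import all_classical all_reals all_analysis.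
From mathcomp Require Import measurable_realfun.
From mathcomp Require Import ring lra zify.
Set Implicit Arguments.
Unset Strict Implicit.
Unset Printing Implicit Defensive.
Import Order.TTheory GRing.Theory Num.Theory.
Import numFieldNormedType.Exports.
Local Open Scope classical_set_scope.
Local Open Scope ring_scope.


(** Write y = mu m for the total service rate and r_i for the probability that
    a Poisson(y) stream has i points during an interarrival time, with
    generating function R(z) = alpha(y - y z). While all servers stay busy the
    departures form this stream, so the balance equations at the states
    j >= m read the same for all n. Numbered downwards from the full state,
    the stationary masses are therefore p c_0, p c_1, ..., p c_{n+1}, where p is
    the loss probability and the sequence c depends on r alone; all of it is
    expressed through the coefficients v_k of 1/(R(z) - z) and their increments
    w_k = v_k - v_{k-1} ([takacs], [takacs_incr]).

    The states below m are eliminated with test functions. The death process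
    with rates mu min(k, m) has, for 0 < j < m, an eigenfunction with eigenvalue
    - mu j, equal to the binomial coefficient C(k, j) for k <= m and growing
    geometrically with ratio m/(m - j) above m ([death_prob_eigen]). Testing the
    stationary law against these functions gives a first-order recursion in j
    for truncated binomial moments. Its first term involves the total mass 1 and
    its last one is the mass of m - 1, that is p c_{n+1}; telescoping yields an
    exact formula for 1/p ([loss_formula]). The geometric growth is only
    apparent: after a cancellation ([geometric_profile]) the terms other than
    v_{n-1} are multiples of w_n and of the convolutions of w with the
    coefficients of (R(x) - R(z))/(x - z), z = 1 - j/m.

    It remains to find the growth of v. If R(s) = s then
    R(x) - x = (s - x)(1 - H(x)), where H has nonnegative coefficients
    ([ddiff]) and H(s) = R'(s), so that s v_k - v_{k-1} is a renewal sequence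
    ([takacs_root_renewal]).
    - If R'(s) < 1 the renewal sequence is summable with weights s^k, and
      s^{k+1} v_k tends to 1/(1 - R'(s)) ([takacs_root_cvg]). The root s = 1
      serves for load > 1, where R'(1) = 1/load; the root s = sigma serves for
      load < 1. The convolution terms converge along with w; their limit is 0 if s = 1
      and gives the factor 1/K if s = sigma.
    - If the load is 1 then H(1) = 1, and factoring 1 - x out of 1 - H(x)
      compares v_n with 2 (n + 1) / rho_2. The error is o(n) in general and
      bounded when rho_3 is finite ([takacs_critical_bounds]); w and the
      convolutions are bounded too, so 1/p equals 2 n / rho_2 up to an error of
      that order. *)

(** * Convolutions and divided differences of power series *)

Definition conv (R : realType) (a b : nat -> R) (n : nat) : R :=
  \sum_(k < n.+1) a k * b (n - k)%N.

(** If A is the value at z of the power series with coefficients a, these are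
    the coefficients, as a power series in x, of the divided difference
    (a(x) - a(z)) / (x - z). The finite sum makes the definition meaningful
    before any convergence is known. *)
Definition ddiff (R : realType) (a : nat -> R) (z A : R) (k : nat) : R :=
  (A - \sum_(i < k.+1) a i * z ^+ i) / z ^+ k.+1.

Definition tail (R : realType) (a : nat -> R) (A : R) (k : nat) : R :=
  A - \sum_(i < k.+1) a i.

Section Convolution.
Context {R : realType}.
Implicit Types (a b h : nat -> R) (z A : R).

Lemma conv0 a b : conv a b 0 = a 0%N * b 0%N.
Proof. by rewrite /conv big_ord_recl big_ord0 addr0. Qed.

Lemma convS a b n :
  conv a b n.+1 = a 0%N * b n.+1 + \sum_(k < n.+1) a k.+1 * b (n - k)%N.
Proof. by rewrite /conv big_ord_recl subn0. Qed.

Lemma eq_convr a b b' n : (forall k, (k <= n)%N -> b k = b' k) ->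
  conv a b n = conv a b' n.
Proof. by move=> e; apply: eq_bigr => k _; rewrite e ?leq_subr. Qed.

Lemma conv_Zr a b c n : conv a (fun k => c * b k) n = c * conv a b n.
Proof. by rewrite /conv mulr_sumr; apply: eq_bigr => k _; rewrite mulrCA. Qed.

Lemma conv_Br a b b' n :
  conv a (fun k => b k - b' k) n = conv a b n - conv a b' n.
Proof. by rewrite /conv -sumrB; apply: eq_bigr => k _; rewrite mulrBr. Qed.

Definition shift a (n : nat) : R := if n is k.+1 then a k else 0.

Lemma conv_shift a b n : conv a (shift b) n = shift (conv a b) n.
Proof.
case: n => [|n] /=; first by rewrite conv0 /= mulr0.
rewrite /conv big_ord_recr /= subnn /= mulr0 addr0.
by apply: eq_bigr => k _; rewrite subSn ?leq_ord.
Qed.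

Lemma conv_ge0 a b n : (forall k, 0 <= a k) -> (forall k, 0 <= b k) ->
  0 <= conv a b n.
Proof. by move=> ha hb; apply: sumr_ge0 => k _; apply: mulr_ge0. Qed.

Lemma ddiff0 a z A : z != 0 -> z * ddiff a z A 0 = A - a 0%N.
Proof.
by move=> z0; rewrite /ddiff big_ord1 expr0 expr1 mulr1 mulrC divfK.
Qed.

Lemma ddiffS a z A k : z != 0 -> z * ddiff a z A k.+1 = ddiff a z A k - a k.+1.
Proof.
move=> z0; have zk : z ^+ k != 0 by rewrite expf_neq0.
rewrite /ddiff [in LHS]big_ord_recr /= !exprS.
by field; rewrite ?zk ?z0.
Qed.

Lemma ddiff1 a A : ddiff a 1 A = tail a A.
Proof.
apply/funext => k; rewrite /ddiff /tail expr1n divr1; congr (_ - _).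
by apply: eq_bigr => i _; rewrite expr1n mulr1.
Qed.

Lemma conv_ddiff0 a z A b : z != 0 ->
  z * conv (ddiff a z A) b 0 = (A - a 0%N) * b 0%N.
Proof. by move=> z0; rewrite conv0 mulrA ddiff0. Qed.

(** The power series identity (x - z) H(x) = a(x) - A, multiplied by b(x). Behind
    it are the renewal equation at a root, the sum rule for the renewal sequence
    at load 1, and the cancellation of the geometric terms. *)
Lemma conv_ddiffS a z A b n : z != 0 ->
  z * conv (ddiff a z A) b n.+1 =
  A * b n.+1 + conv (ddiff a z A) b n - conv a b n.+1.
Proof.
move=> z0; rewrite !convS mulrDr mulrA ddiff0// mulr_sumr.
under eq_bigr do rewrite mulrA ddiffS// mulrBl.
by rewrite sumrB /conv; ring.
Qed.

End Convolution.

(** * Renewal sequences *)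

Section SeriesFacts.
Context {R : realType}.
Implicit Types (a b h : nat -> R) (z A l : R).

Lemma series_le_lim a l n : (forall k, 0 <= a k) -> series a @ \oo --> l ->
  series a n <= l.
Proof.
move=> a0 al; rewrite -(cvg_lim _ al)//.
apply: nondecreasing_cvgn_le; last by apply/cvg_ex; exists l.
exact: nondecreasing_series.
Qed.

Lemma partial_sum_le a l n : (forall k, 0 <= a k) -> series a @ \oo --> l ->
  \sum_(i < n) a i <= l.
Proof. by move=> a0 al; have := series_le_lim n a0 al; rewrite /series /= big_mkord. Qed.

Lemma seriesE a n : series a n = \sum_(i < n) a i.
Proof. by rewrite /series /= big_mkord. Qed.

Lemma cvg_bounded a l : a @ \oo --> l -> exists2 M : R, 0 < M & forall n, `|a n| <= M.
Proof.
move=> al; have /cvg_seq_bounded : cvgn a by apply/cvg_ex; exists l.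
move=> /pinfty_ex_gt0[M M0 hM]; exists M => // n.
exact: hM.
Qed.

(** For large n the indices k <= n - N1 see a small d, and the other ones carry
    little of the mass of h. *)
Lemma conv_cvg0 h l d : (forall k, 0 <= h k) -> series h @ \oo --> l ->
  d @ \oo --> (0 : R) -> conv h d @ \oo --> (0 : R).
Proof.
move=> h0 hl d0.
have [M M0 dM] := cvg_bounded d0.
have l0 : 0 <= l by apply: le_trans (partial_sum_le 0 h0 hl); rewrite big_ord0.
apply/cvgrPdist_le => e e0.
have e1 : 0 < e / (2 * (l + 1)) by rewrite divr_gt0// mulr_gt0// ltr_wpDl.
have e2 : 0 < e / (2 * M) by rewrite divr_gt0// mulr_gt0.
have [N1 _ HN1] : \forall n \near \oo, `|0 - d n| <= e / (2 * (l + 1)).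
  by move/cvgrPdist_le : d0; exact.
have [N2 _ HN2] : \forall n \near \oo, `|l - series h n| <= e / (2 * M).
  by move/cvgrPdist_le : hl; exact.
exists (N1 + N2)%N => // n /= Nn.
rewrite sub0r normrN /conv.
have nN1 : (n.+1 - N1 <= n.+1)%N by rewrite leq_subr.
rewrite (le_trans (ler_norm_sum _ _ _))//.
rewrite (eq_bigr (fun k : 'I_n.+1 => h k * `|d (n - k)%N|)); last first.
  by move=> k _; rewrite normrM ger0_norm.
rewrite -(big_mkord xpredT (fun k => h k * `|d (n - k)%N|)).
rewrite (big_cat_nat (n := (n.+1 - N1)%N))//=.
have -> : e = e / 2 + e / 2 by field.
apply: lerD.
- apply: (@le_trans _ _ (\sum_(0 <= k < n.+1 - N1) h k * (e / (2 * (l + 1))))).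
    rewrite big_nat [leRHS]big_nat; apply: ler_sum => k /andP[_ kn].
    apply: ler_wpM2l => //; have := HN1 (n - k)%N; rewrite sub0r normrN.
    by apply => /=; lia.
  rewrite -mulr_suml.
  have := series_le_lim (n.+1 - N1)%N h0 hl; rewrite /series /= => hle.
  rewrite (le_trans (ler_wpM2r _ hle))//; first by rewrite ltW.
  have -> : l * (e / (2 * (l + 1))) = e / 2 * (l / (l + 1)).
    by field; rewrite lt0r_neq0// ltr_wpDl.
  rewrite ler_piMr//; first by rewrite divr_ge0// ltW.
  by rewrite ler_pdivrMr ?ltr_wpDl// mul1r lerDl.
- apply: (@le_trans _ _ (\sum_(n.+1 - N1 <= k < n.+1) h k * M)).
    by apply: ler_sum => k _; apply: ler_wpM2l.
  rewrite -mulr_suml.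
  have -> : \sum_(n.+1 - N1 <= k < n.+1) h k = series h n.+1 - series h (n.+1 - N1)%N.
    by rewrite sub_series_geq.
  have /= H2 : `|l - series h (n.+1 - N1)%N| <= e / (2 * M) by apply: HN2 => /=; lia.
  have := series_le_lim n.+1 h0 hl => H3.
  have {}H2 : l - series h (n.+1 - N1)%N <= e / (2 * M) by rewrite (le_trans (ler_norm _)).
  have : series h n.+1 - series h (n.+1 - N1)%N <= e / (2 * M) by lra.
  move=> H4; rewrite (le_trans (ler_wpM2r (ltW M0) H4))//.
  by rewrite le_eqVlt; apply/orP; left; apply/eqP; field; rewrite lt0r_neq0.
Qed.

Lemma conv_cvg h l b c : (forall k, 0 <= h k) -> series h @ \oo --> l ->
  b @ \oo --> c -> conv h b @ \oo --> l * c.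
Proof.
move=> h0 hl bc.
have -> : conv h b = (fun n => conv h (fun k => b k - c) n + series h n.+1 * c).
  apply/funext => n; rewrite seriesE mulr_suml /conv -big_split /=.
  by apply: eq_bigr => k _; ring.
rewrite -[l * c]add0r; apply: cvgD.
  apply: (conv_cvg0 h0 hl).
  by rewrite -(subrr c); apply: cvgB => //; exact: cvg_cst.
apply: cvgM; last exact: cvg_cst.
by rewrite cvg_shiftS.
Qed.

Lemma renewal_ge0 h u : (forall k, 0 <= h k) -> h 0%N < 1 ->
  (forall n, u n = (n == 0)%:R + conv h u n) -> forall n, 0 <= u n.
Proof.
move=> h0 h1 hu n; elim/ltn_ind: n => n IH.
have p1 : 0 < 1 - h 0%N by rewrite subr_gt0.
have : (1 - h 0%N) * u n = (n == 0)%:R + \sum_(k < n) h k.+1 * u (n - k.+1)%N.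
  rewrite mulrBl mul1r {1}hu /conv big_ord_recl subn0 /=.
  rewrite [X in X - _]addrCA [X in X - _]addrC addrK.
  by congr (_ + _).
move=> E; rewrite -(pmulr_rge0 _ p1) E addr_ge0//.
by apply: sumr_ge0 => k _; rewrite mulr_ge0// IH//; case: k => k /= kn; lia.
Qed.

(** The partial sums S solve S = 1 + h * S, which bounds them by 1/(1 - l) and
    identifies their limit. *)
Lemma renewal_subcritical h u l : (forall k, 0 <= h k) ->
  series h @ \oo --> l -> l < 1 ->
  (forall n, u n = (n == 0)%:R + conv h u n) -> series u @ \oo --> (1 - l)^-1.
Proof.
move=> h0 hl l1 hu.
have h01 : h 0%N < 1.
  by apply: le_lt_trans l1; have := partial_sum_le 1 h0 hl; rewrite big_ord1.
have u0 := renewal_ge0 h0 h01 hu.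
have p1 : 0 < 1 - l by rewrite subr_gt0.
pose S n := series u n.+1.
have SE n : S n = 1 + conv h S n.
  elim: n => [|n IH].
    by rewrite /S seriesE big_ord1 conv0 {1}hu conv0 /= /S seriesE big_ord1.
  rewrite {1}/S seriesSr /= -/(S n) IH hu /= add0r -addrA; congr (_ + _).
  rewrite /conv [in RHS]big_ord_recr /= subnn.
  rewrite (big_ord_recr n.+1) /= subnn addrA; congr (_ + _); last first.
    by rewrite /S seriesE big_ord1.
  rewrite -big_split /=; apply: eq_bigr => k _.
  by rewrite -mulrDr subSn ?leq_ord// /S [in RHS]seriesSr.
have S0 n : 0 <= S n by rewrite /S seriesE sumr_ge0.
have Smono : nondecreasing_seq S.
  by apply/nondecreasing_seqP => n; rewrite /S [leRHS]seriesSr lerDl.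
have Sle n : S n <= (1 - l)^-1.
  rewrite -[leRHS]mul1r ler_pdivlMr// mulrBr mulr1 lerBlDr {1}SE lerD2l.
  apply: (@le_trans _ _ (\sum_(k < n.+1) h k * S n)).
    by apply: ler_sum => k _; apply: ler_wpM2l => //; apply: Smono; rewrite leq_subr.
  by rewrite -mulr_suml mulrC ler_wpM2l// partial_sum_le.
have /cvg_ex[/= s Ss] : cvgn S.
  apply: nondecreasing_is_cvgn => //; exists (1 - l)^-1 => _ [n _ <-].
  exact: Sle.
have sE : s = 1 + l * s.
  apply: (@cvg_unique _ _ (S @ \oo)) => //.
  rewrite (funext SE); apply: cvgD; first exact: cvg_cst.
  exact: conv_cvg.
have -> : (1 - l)^-1 = s.
  apply: (mulfI (lt0r_neq0 p1)); rewrite divff ?lt0r_neq0//.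
  by rewrite mulrBl mul1r {1}sE addrK.
by rewrite -cvg_shiftS.
Qed.

(** Solved for u_n, the renewal equation bounds it by an average of earlier
    terms with weights of total at most 1. *)
Lemma renewal_le h u l : (forall k, 0 <= h k) ->
  series h @ \oo --> l -> l <= 1 -> h 0%N < 1 ->
  (forall n, u n = (n == 0)%:R + conv h u n) -> forall n, u n <= u 0%N.
Proof.
move=> h0 hl l1 h01 hu n; elim/ltn_ind: n => -[//|n] IH.
have u0 := renewal_ge0 h0 h01 hu.
have p1 : 0 < 1 - h 0%N by rewrite subr_gt0.
have E : (1 - h 0%N) * u n.+1 = \sum_(k < n.+1) h k.+1 * u (n - k)%N.
  by rewrite mulrBl mul1r {1}hu convS /= add0r [X in X - _]addrC addrK.
rewrite -(ler_pM2l p1) E.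
apply: (@le_trans _ _ (\sum_(k < n.+1) h k.+1 * u 0%N)).
  by apply: ler_sum => k _; rewrite ler_wpM2l// IH// ltnS leq_subr.
rewrite -mulr_suml ler_wpM2r// lerBrDr addrC.
have := partial_sum_le n.+2 h0 hl; rewrite big_ord_recl => /le_trans; exact.
Qed.

End SeriesFacts.

(** * Summation of divided differences and of tails *)

Section DividedDifferences.
Context {R : realType}.
Implicit Types (a b h : nat -> R) (y z A B M : R).

Lemma tail_le a b A B n : (forall i, (n <= i)%N -> a i <= b i) ->
  series a @ \oo --> A -> series b @ \oo --> B ->
  A - \sum_(i < n) a i <= B - \sum_(i < n) b i.
Proof.
move=> ab aA bB; rewrite -!seriesE.
have cA : (fun N => series a N - series a n) @ \oo --> A - series a n.
  by apply: cvgB => //; exact: cvg_cst.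
have cB : (fun N => series b N - series b n) @ \oo --> B - series b n.
  by apply: cvgB => //; exact: cvg_cst.
rewrite -(cvg_lim _ cA)// -(cvg_lim _ cB)//.
apply: ler_lim; [by apply/cvg_ex; eexists; exact: cA|by apply/cvg_ex; eexists; exact: cB|].
near=> N.
have nN : (n <= N)%N by near: N; exact: nbhs_infty_ge.
rewrite !sub_series_geq// !big_nat; apply: ler_sum => i /andP[ni _].
exact: ab.
Unshelve. all: by end_near. Qed.

Lemma ddiff_ge0 a z A k : (forall i, 0 <= a i) -> 0 < z ->
  series (fun i => a i * z ^+ i) @ \oo --> A -> 0 <= ddiff a z A k.
Proof.
move=> a0 z0 aA; apply: divr_ge0; last by rewrite exprn_ge0// ltW.
rewrite subr_ge0; apply: (partial_sum_le _ _ aA) => i.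
by rewrite mulr_ge0// exprn_ge0// ltW.
Qed.

Lemma ddiff_homo a y z A B k : (forall i, 0 <= a i) -> 0 < z -> z <= y ->
  series (fun i => a i * z ^+ i) @ \oo --> A ->
  series (fun i => a i * y ^+ i) @ \oo --> B ->
  ddiff a z A k <= ddiff a y B k.
Proof.
move=> a0 z0 zy aA aB; have y0 := lt_le_trans z0 zy.
have scale x (C : R) : series (fun i => a i * x ^+ i) @ \oo --> C ->
    series (fun i => a i * x ^+ i * (x ^+ k.+1)^-1) @ \oo --> C / x ^+ k.+1.
  move=> aC.
  have -> : series (fun i => a i * x ^+ i * (x ^+ k.+1)^-1) =
      (fun n => series (fun i => a i * x ^+ i) n * (x ^+ k.+1)^-1).
    by apply/funext => n; rewrite !seriesE mulr_suml.
  by apply: cvgM => //; exact: cvg_cst.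
rewrite /ddiff !mulrBl !mulr_suml.
apply: (tail_le _ (scale _ _ aA) (scale _ _ aB)) => i ki.
rewrite -!mulrA; apply: ler_wpM2l => //.
have E (x : R) : 0 < x -> x ^+ i / x ^+ k.+1 = x ^+ (i - k.+1).
  by move=> x0; rewrite -{1}(subnK ki) exprD mulfK// expf_neq0// lt0r_neq0.
by rewrite !E// lerXn2r// nnegrE ltW.
Qed.

(** Formally this is (B - A)/(y - z), the value at y of the divided difference;
    the remainder after n terms is y^n times the coefficient of index n - 1, up to
    a constant factor, and is at most a tail of one of the two given series. *)
Lemma ddiff_series a y z A B : (forall i, 0 <= a i) -> 0 < z -> 0 < y -> y != z ->
  series (fun i => a i * z ^+ i) @ \oo --> A ->
  series (fun i => a i * y ^+ i) @ \oo --> B ->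
  series (fun k => ddiff a z A k * y ^+ k) @ \oo --> (B - A) / (y - z).
Proof.
move=> a0 z0 y0 yz aA aB.
pose g n := (A - \sum_(i < n) a i * z ^+ i) / z ^+ n.
have E n : (z - y) * series (fun k => ddiff a z A k * y ^+ k) n =
    A - series (fun i => a i * y ^+ i) n - y ^+ n * g n.
  rewrite !seriesE; elim: n => [|n IH].
    by rewrite !big_ord0 /g big_ord0 expr0 divr1 mul1r mulr0; ring.
  rewrite !big_ord_recr /= mulrDr IH.
  have -> : ddiff a z A n = g n.+1 by [].
  have : z * g n.+1 = g n - a n.
    have zn : z ^+ n != 0 by rewrite expf_neq0 ?lt0r_neq0.
    have zN : z != 0 by rewrite lt0r_neq0.
    by rewrite /g big_ord_recr /= exprS; field; rewrite ?zn ?zN.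
  move=> zg; rewrite !mulrDl ?mulrDr mulrA zg mulNr !exprS; ring.
have yg0 : (fun n => y ^+ n.+1 * g n.+1) @ \oo --> (0 : R).
  have cv x (C : R) : 0 < x -> series (fun i => a i * x ^+ i) @ \oo --> C ->
      (fun n => x ^+ n.+1 * ddiff a x C n) @ \oo --> (0 : R).
    move=> x0 aC.
    have -> : (fun n => x ^+ n.+1 * ddiff a x C n) =
        (fun n => C - series (fun i => a i * x ^+ i) n.+1).
      apply/funext => n; rewrite seriesE /ddiff mulrC divfK//.
      by rewrite expf_neq0 ?lt0r_neq0.
    rewrite -(subrr C); apply: cvgB; first exact: cvg_cst.
    by rewrite cvg_shiftS.
  have gE n : g n.+1 = ddiff a z A n by [].
  have g0 n : 0 <= g n.+1 by rewrite gE; exact: ddiff_ge0.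
  have [zy|zy] := leP z y.
    apply: (squeeze_cvgr _ (cvg_cst 0) (cv _ _ y0 aB)); near=> n.
    rewrite mulr_ge0 ?exprn_ge0 ?(ltW y0)//= gE ler_wpM2l//.
      by rewrite exprn_ge0// ltW.
    exact: ddiff_homo.
  apply: (squeeze_cvgr _ (cvg_cst 0) (cv _ _ z0 aA)); near=> n.
  rewrite mulr_ge0 ?exprn_ge0 ?(ltW y0)//= -gE ler_wpM2r//.
  by rewrite lerXn2r// ?nnegrE ltW.
have zy0 : z - y != 0 by rewrite subr_eq0 eq_sym.
have -> : (B - A) / (y - z) = (z - y)^-1 * (A - B - 0).
  by field; rewrite zy0 subr_eq0 yz.
rewrite -cvg_shiftS.
have -> : (fun n => series (fun k => ddiff a z A k * y ^+ k) n.+1) =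
   (fun n => (z - y)^-1 * (A - series (fun i => a i * y ^+ i) n.+1 - y ^+ n.+1 * g n.+1)).
  by apply/funext => n; rewrite -E mulrA mulVf// mul1r.
apply: cvgM; first exact: cvg_cst.
apply: cvgB => //; apply: cvgB; first exact: cvg_cst.
by rewrite cvg_shiftS.
Unshelve. all: by end_near. Qed.

(** Exchange of summations, through sum_(k < i) C(k, l) = C(i, l+1). The boundary
    term C(n, l+1) (A - a_0 - ... - a_(n-1)) is dominated by a tail of the series
    that sums to M. Iterated, it turns factorial moments of a law into moments of
    its tails. *)
Lemma tail_binomial_series a A M (l : nat) : (forall i, 0 <= a i) ->
  series a @ \oo --> A ->
  series (fun i => 'C(i, l.+1)%:R * a i) @ \oo --> M ->
  series (fun k => 'C(k, l)%:R * tail a A k) @ \oo --> M.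
Proof.
move=> a0 aA aM.
pose T n := 'C(n, l.+1)%:R * (A - \sum_(i < n) a i).
have E n : series (fun k => 'C(k, l)%:R * tail a A k) n =
    T n + series (fun i => 'C(i, l.+1)%:R * a i) n.
  rewrite !seriesE /T; elim: n => [|n IH].
    by rewrite !big_ord0 bin0n mul0r addr0.
  by rewrite big_ord_recr /= IH binS natrD /tail !big_ord_recr /=; ring.
rewrite (funext E) -[M]add0r; apply: cvgD => //.
have cM : (fun n => M - series (fun i => 'C(i, l.+1)%:R * a i) n) @ \oo --> (0 : R).
  by rewrite -(subrr M); apply: cvgB => //; exact: cvg_cst.
apply: (squeeze_cvgr _ (cvg_cst 0) cM); near=> n; apply/andP; split.
  by rewrite mulr_ge0// subr_ge0; exact: partial_sum_le.
rewrite seriesE /T mulrBr mulr_sumr.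
apply: (@tail_le (fun i => 'C(n, l.+1)%:R * a i)
  (fun i => 'C(i, l.+1)%:R * a i)) => //; last first.
  have -> : series (fun i => 'C(n, l.+1)%:R * a i) =
      (fun N => 'C(n, l.+1)%:R * series a N).
    by apply/funext => N; rewrite !seriesE mulr_sumr.
  by apply: cvgM => //; exact: cvg_cst.
by move=> i ni; rewrite ler_wpM2r// ler_nat leq_bin2l.
Unshelve. all: by end_near. Qed.

End DividedDifferences.

(** * The coefficients of 1 / (R(z) - z) *)

(** The list of the first n + 1 coefficients of 1/(R(z) - z), last one first:
    the recursion needs all the previous values. *)
Fixpoint takacs_prefix (R : realType) (r : nat -> R) (n : nat) : seq R :=
  if n is k.+1 then
    let s := takacs_prefix r k in
    (head 0 s - \sum_(i < n) r i.+1 * s`_i) / r 0%N :: s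
  else [:: (r 0%N)^-1].

Definition takacs (R : realType) (r : nat -> R) (n : nat) : R := head 0 (takacs_prefix r n).

Section GeneratingFunction.
Context {R : realType}.
Implicit Types (r : nat -> R) (z A D : R).

Lemma nth_takacs_prefix r n k : (k <= n)%N -> (takacs_prefix r n)`_k = takacs r (n - k)%N.
Proof. by elim: n k => [|n IH] [|k] //= kn; rewrite subSS IH. Qed.

Lemma conv_takacs r n : r 0%N != 0 -> conv r (takacs r) n = (n == 0)%:R + shift (takacs r) n.
Proof.
move=> r0; case: n => [|n].
  by rewrite conv0 /takacs /= addr0 divff.
rewrite convS {1}/takacs /= -/(takacs r n) add0r mulrC divfK//.
rewrite [X in _ - X](eq_bigr (fun k : 'I_n.+1 => r k.+1 * takacs r (n - k)%N)) ?subrK//.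
by move=> k _; rewrite nth_takacs_prefix ?leq_ord.
Qed.

(** The factorization R(x) - x = (z - x) (1 - H(x)) at a root z of R(z) = z:
    multiplying 1/(R(x) - x) by z - x leaves 1/(1 - H(x)). The hypothesis
    R(z) = z is hidden in the last argument of ddiff, where z stands for the
    value R(z). *)
Lemma takacs_root_renewal r z n : r 0%N != 0 -> z != 0 ->
  let u k := z * takacs r k - shift (takacs r) k in
  u n = (n == 0)%:R + conv (ddiff r z z) u n.
Proof.
move=> r0 z0 u; rewrite /u conv_Br conv_Zr conv_shift.
have := conv_takacs n r0; case: n => [|n].
  by rewrite conv_ddiff0// conv0 /= => E; rewrite mulrBl E; ring.
by rewrite conv_ddiffS// /= => ->; ring.
Qed.

Lemma conv_geometric (a b : nat -> R) z n :
  conv (fun k => a k * z ^+ k) (fun k => b k * z ^+ k) n = conv a b n * z ^+ n :> R.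
Proof.
rewrite /conv mulr_suml; apply: eq_bigr => k _.
have -> : z ^+ n = z ^+ k * z ^+ (n - k) by rewrite -exprD subnKC ?leq_ord.
by ring.
Qed.

Lemma takacs_root_sum r z n :
  series (fun k => (z * takacs r k - shift (takacs r) k) * z ^+ k) n.+1 = z ^+ n.+1 * takacs r n.
Proof.
elim: n => [|n IH]; first by rewrite seriesE big_ord1 /= subr0 expr0 expr1 mulr1.
by rewrite seriesSr IH /= !exprS; ring.
Qed.

(** On the diagonal the divided difference is the derivative: D = z R'(z). *)
Lemma ddiff_diag_series r z A D : (forall i, 0 <= r i) -> 0 < z ->
  series (fun i => r i * z ^+ i) @ \oo --> A ->
  series (fun i => i%:R * (r i * z ^+ i)) @ \oo --> D ->
  series (fun k => ddiff r z A k * z ^+ k) @ \oo --> D / z.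
Proof.
move=> r0 z0 rA rD.
have -> : series (fun k => ddiff r z A k * z ^+ k) =
  (fun n => series (fun k => 'C(k, 0)%:R * tail (fun i => r i * z ^+ i) A k) n * z^-1).
  apply/funext => n; rewrite !seriesE mulr_suml; apply: eq_bigr => k _.
  have zk : z ^+ k != 0 by rewrite expf_neq0 ?lt0r_neq0.
  have zN : z != 0 by rewrite lt0r_neq0.
  by rewrite /ddiff /tail bin0 exprS; field; rewrite ?zk ?zN.
apply: cvgM; last exact: cvg_cst.
apply: (@tail_binomial_series _ (fun i => r i * z ^+ i)) => //.
  by move=> i; rewrite mulr_ge0// exprn_ge0// ltW.
by under eq_fun do rewrite bin1.
Qed.

Lemma takacs_root_cvg r z D : (forall i, 0 <= r i) -> 0 < r 0%N -> 0 < z ->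
  series (fun i => r i * z ^+ i) @ \oo --> z ->
  series (fun i => i%:R * (r i * z ^+ i)) @ \oo --> D -> D / z < 1 ->
  (fun n => z ^+ n.+1 * takacs r n) @ \oo --> (1 - D / z)^-1.
Proof.
move=> r0 r00 z0 rz rD D1.
rewrite (_ : (fun n => _) =
    fun n => series (fun k => (z * takacs r k - shift (takacs r) k) * z ^+ k) n.+1); last first.
  by apply/funext => n; rewrite takacs_root_sum.
rewrite cvg_shiftS.
apply: (renewal_subcritical _ (ddiff_diag_series r0 z0 rz rD) D1).
  by move=> k; rewrite mulr_ge0 ?exprn_ge0 ?(ltW z0)//; exact: ddiff_ge0.
move=> n; rewrite conv_geometric takacs_root_renewal ?lt0r_neq0// mulrDl.
by congr (_ + _); case: n => [|n]; rewrite ?mulr1 ?mul0r.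
Qed.

End GeneratingFunction.

(** * Growth of the coefficients at load 1 *)

Section CriticalGrowth.
Context {R : realType}.
Variables (r : nat -> R) (M : R).
Hypotheses (r_ge0 : forall i, 0 <= r i) (r0_gt0 : 0 < r 0%N)
  (r_sum : series r @ \oo --> (1 : R))
  (r_mean : series (fun i => i%:R * r i) @ \oo --> (1 : R))
  (r_fact2 : series (fun i => 'C(i, 2)%:R * r i) @ \oo --> M).

(* [t] is the renewal distribution of [w]; [s] is its integrated tail, whose
   total mass M is the mean of [t], that is half the second factorial moment. *)
Let t := tail r 1.
Let s := tail t 1.
Let v := takacs r.
Let w n := v n - shift v n.

Let t_ge0 k : 0 <= t k.
Proof. by rewrite /t /tail subr_ge0; exact: partial_sum_le. Qed.

Let t_sum : series t @ \oo --> (1 : R).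
Proof.
have -> : t = (fun k => 'C(k, 0)%:R * tail r 1 k).
  by apply/funext => k; rewrite bin0 mul1r.
apply: tail_binomial_series => //.
by under eq_fun do rewrite bin1.
Qed.

Let s_ge0 k : 0 <= s k.
Proof. by rewrite /s /tail subr_ge0; exact: partial_sum_le. Qed.

Let s_sum : series s @ \oo --> M.
Proof.
have -> : s = (fun k => 'C(k, 0)%:R * tail t 1 k).
  by apply/funext => k; rewrite bin0 mul1r.
apply: tail_binomial_series => //.
exact: tail_binomial_series.
Qed.

Let t0 : t 0%N = 1 - r 0%N.
Proof. by rewrite /t /tail big_ord1. Qed.

Let w_renewal n : w n = (n == 0)%:R + conv t w n.
Proof.
have := takacs_root_renewal n (lt0r_neq0 r0_gt0) (oner_neq0 R).
rewrite /= ddiff1 mul1r -/t -/v -/(w n) => ->; congr (_ + _).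
by apply: eq_convr => k _; rewrite mul1r.
Qed.

Let w0 : w 0%N = (r 0%N)^-1.
Proof. by rewrite /w /v /takacs /= subr0. Qed.

Lemma takacs_incr_bounds n : 0 <= w n <= (r 0%N)^-1.
Proof.
have t1 : t 0%N < 1 by rewrite t0 ltrBlDr ltrDl.
by rewrite (renewal_ge0 t_ge0 t1 w_renewal) -w0 (renewal_le t_ge0 t_sum _ t1 w_renewal).
Qed.

(* With T(x) and S(x) the generating functions of [t] and [s],
   1 - T(x) = (1 - x) S(x) and w has generating function 1/(1 - T). *)
Let conv_sw n : conv s w n = 1.
Proof.
elim: n => [|n IH].
  rewrite -[LHS]mul1r /s -ddiff1 conv_ddiff0 ?oner_eq0// w0 t0.
  by rewrite subKr divff// lt0r_neq0.
rewrite -[LHS]mul1r /s -ddiff1 conv_ddiffS ?oner_eq0// ddiff1 -/s IH.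
by rewrite {1}w_renewal /=; ring.
Qed.

Lemma takacs_sum_increments n : v n = series w n.+1.
Proof.
elim: n => [|n IH]; first by rewrite seriesE big_ord1 /w /= subr0.
by rewrite seriesSr -IH /w /=; ring.
Qed.

Let conv_sv n : conv s v n = n.+1%:R.
Proof.
elim: n => [|n IH].
  by rewrite -(conv_sw 0) !conv0 /w /= subr0.
have := conv_sw n.+1; rewrite /w conv_Br conv_shift /= IH => E.
by move/eqP: E; rewrite subr_eq => /eqP ->; rewrite -[RHS]natr1 addrC.
Qed.

(** Since s * v = n + 1, the difference M v_n - (n + 1) is the sum of the
    s_k (v_n - v_(n-k)), with v_(n-k) read as 0 for k > n. The increments of v
    are at most 1/r_0, so it is at most the sum of the s_k min(k, n+1), up to this
    factor; the latter sum is a partial sum of tails of s. *)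
Lemma takacs_critical_bounds n :
  0 <= M * v n - n.+1%:R <= (r 0%N)^-1 * series (tail s M) n.+1.
Proof.
have vB k : (k <= n)%N -> 0 <= v n - v (n - k)%N <= (r 0%N)^-1 * k%:R.
  move=> kn; have -> : v n - v (n - k)%N = \sum_((n - k).+1 <= i < n.+1) w i.
    by rewrite !takacs_sum_increments sub_series_geq// ltnS leq_subr.
  apply/andP; split; first by apply: sumr_ge0 => i _; have /andP[] := takacs_incr_bounds i.
  have -> : (r 0%N)^-1 * k%:R = \sum_((n - k).+1 <= i < n.+1) (r 0%N)^-1.
    by rewrite sumr_const_nat subSS subKn// mulr_natr.
  by apply: ler_sum => i _; have /andP[] := takacs_incr_bounds i.
have vn : 0 <= v n <= (r 0%N)^-1 * n.+1%:R.
  rewrite takacs_sum_increments seriesE; apply/andP; split.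
    by apply: sumr_ge0 => i _; have /andP[] := takacs_incr_bounds i.
  have -> : (r 0%N)^-1 * n.+1%:R = \sum_(i < n.+1) (r 0%N)^-1.
    by rewrite sumr_const card_ord mulr_natr.
  by apply: ler_sum => i _; have /andP[] := takacs_incr_bounds i.
have E : M * v n - n.+1%:R =
    tail s M n * v n + \sum_(k < n.+1) s k * (v n - v (n - k)%N).
  have -> : \sum_(k < n.+1) s k * (v n - v (n - k)%N) =
      (\sum_(k < n.+1) s k) * v n - conv s v n.
    by rewrite mulr_suml /conv -sumrB; apply: eq_bigr => k _; rewrite mulrBr.
  by rewrite conv_sv /tail; ring.
have tail_ge0 : 0 <= tail s M n by rewrite /tail subr_ge0; exact: partial_sum_le.
rewrite E; apply/andP; split.
  rewrite addr_ge0 ?mulr_ge0//; first by case/andP: vn.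
  by apply: sumr_ge0 => k _; rewrite mulr_ge0//; case/andP: (vB k (leq_ord k)).
have -> : series (tail s M) n.+1 = n.+1%:R * tail s M n + \sum_(k < n.+1) s k * k%:R.
  rewrite seriesE; move: (n); elim => [|k IH]; first by rewrite !big_ord1 mulr0; ring.
  rewrite big_ord_recr /= IH [in RHS]big_ord_recr /=.
  have -> : tail s M k = tail s M k.+1 + s k.+1.
    by rewrite /tail [in RHS]big_ord_recr /=; ring.
  by rewrite -[k.+2%:R]natr1; ring.
rewrite mulrDr; apply: lerD.
  by rewrite mulrA [leRHS]mulrC ler_wpM2l//; case/andP: vn.
rewrite mulr_sumr; apply: ler_sum => k _; rewrite mulrCA ler_wpM2l//.
by case/andP: (vB k (leq_ord k)).
Qed.

Let s0 : s 0%N = r 0%N.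
Proof. by rewrite /s /tail big_ord1 t0 subKr. Qed.

Lemma critical_drift_gt0 : 0 < M.
Proof.
apply: (lt_le_trans r0_gt0); rewrite -s0.
by have := partial_sum_le 1 s_ge0 s_sum; rewrite big_ord1.
Qed.

(** The tails of s tend to 0, hence so do their Cesaro means. *)
Lemma takacs_critical_cvg : (fun n => v n / n.+1%:R) @ \oo --> M^-1.
Proof.
have M0 := critical_drift_gt0.
have ces : (fun n => n.+1%:R^-1 * series (tail s M) n.+1) @ \oo --> (0 : R).
  apply: (@cesaro _ (tail s M)); rewrite -(subrr M); apply: cvgB; first exact: cvg_cst.
  have -> : (fun n => \sum_(i < n.+1) s i) = (fun n => series s n.+1).
    by apply/funext => n; rewrite seriesE.
  by rewrite cvg_shiftS.
have d : (fun n => M * v n / n.+1%:R - 1) @ \oo --> (0 : R).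
  have c0 : (fun n => (r 0%N)^-1 * (n.+1%:R^-1 * series (tail s M) n.+1)) @ \oo --> (0 : R).
    by rewrite -[0](mulr0 (r 0%N)^-1); apply: cvgM => //; exact: cvg_cst.
  apply: (squeeze_cvgr _ (cvg_cst 0) c0); near=> n.
  have -> : M * v n / n.+1%:R - 1 = n.+1%:R^-1 * (M * v n - n.+1%:R).
    by rewrite mulrBr mulVf ?pnatr_eq0// mulrC.
  have /andP[h1 h2] := takacs_critical_bounds n.
  by rewrite mulr_ge0 ?invr_ge0//= mulrCA ler_wpM2l ?invr_ge0.
have -> : (fun n => v n / n.+1%:R) = (fun n => M^-1 * ((M * v n / n.+1%:R - 1) + 1)).
  apply/funext => n; rewrite subrK -!mulrA mulKf// lt0r_neq0//.
have {2}-> : M^-1 = M^-1 * (0 + 1) by rewrite add0r mulr1.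
apply: cvgM; first exact: cvg_cst.
by apply: cvgD => //; exact: cvg_cst.
Unshelve. all: by end_near. Qed.

Lemma takacs_critical_bounded M3 :
  series (fun i => 'C(i, 3)%:R * r i) @ \oo --> (M3 : R) ->
  forall n, `|M * v n - n.+1%:R| <= (r 0%N)^-1 * M3.
Proof.
move=> r3 n; have /andP[h1 h2] := takacs_critical_bounds n.
rewrite ger0_norm// (le_trans h2)// ler_wpM2l ?invr_ge0//.
apply: series_le_lim => [k|]; first by rewrite /tail subr_ge0; exact: partial_sum_le.
have -> : tail s M = (fun k => 'C(k, 0)%:R * tail s M k).
  by apply/funext => k; rewrite bin0 mul1r.
do 2! (apply: tail_binomial_series => //).
exact: tail_binomial_series.
Qed.

End CriticalGrowth.

(** * The death process *)

Section ExponentialConvolution.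
Context {R : realType}.
Implicit Types (f g H : R -> R) (r t : R).

Lemma is_derive1_continuous f (x d : R) : is_derive x 1 f d -> {for x, continuous f}.
Proof.
by case=> df _; apply/differentiable_continuous; rewrite -derivable1_diffP.
Qed.

Lemma is_derive_reflect f (t s d : R) :
  is_derive (t - s) 1 f d -> is_derive s 1 (fun s => f (t - s)) (- d).
Proof.
move=> fd.
have -> : (fun s : R => f (t - s)) = f \o (fun s : R => t - s) by [].
rewrite -[- d]mulN1r mulrC; apply: is_derive1_comp.
have : is_derive s 1 (cst t - id) (0 - 1) by apply: is_deriveB.
by rewrite sub0r.
Qed.

Lemma Rintegral_FTC2 f F t : 0 <= t -> continuous f ->
  (forall s, 0 <= s <= t -> is_derive s 1 F (f s)) ->
  \int[lebesgue_measure]_(s in `[0, t]) f s = F t - F 0.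
Proof.
move=> t0 cf dF; have [->|tn0] := eqVneq t 0.
  by rewrite set_itv1 Rintegral_set1 subrr.
have tp : 0 < t by rewrite lt_neqAle eq_sym tn0.
rewrite /Rintegral (@continuous_FTC2 _ f F)//.
- exact: continuous_subspaceT.
- split.
  + move=> x /[!in_itv]/= /andP[x0 xt].
    by have [] := dF x (introT andP (conj (ltW x0) (ltW xt))).
  + apply: cvg_at_right_filter.
    by apply: (is_derive1_continuous (d := f 0)); apply: dF; rewrite lexx ltW.
  + apply: cvg_at_left_filter.
    by apply: (is_derive1_continuous (d := f t)); apply: dF; rewrite lexx ltW.
- move=> x /[!in_itv]/= /andP[x0 xt].
  have [_ <-] := dF x (introT andP (conj (ltW x0) (ltW xt))).
  by rewrite derive1E.
Qed.

Lemma exp_linear_continuous r : continuous (fun s : R => expR (r * s)).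
Proof.
move=> x; apply: continuous_comp; last exact: continuous_expR.
by apply: cvgM; [exact: cvg_cst|exact: cvg_id].
Qed.

Lemma exp_kernel_continuous r g t : continuous g ->
  continuous (fun s : R => r * expR (- r * s) * g (t - s)).
Proof.
move=> cg x; apply: cvgM.
  by apply: cvgM; [exact: cvg_cst|exact: exp_linear_continuous].
apply: (@continuous_comp _ _ _ (fun s : R => t - s) g); last exact: cg.
by apply: cvgB; [exact: cvg_cst|exact: cvg_id].
Qed.

(** Conditioning on an exponential holding time convolves with an exponential
    density. With u = t - s the integrand is expR (- r t) times the derivative of
    H at u. *)
Lemma exp_conv_FTC r f g H t : 0 <= t -> continuous g ->
  (forall u : R, 0 <= u -> f u = g u) ->
  (forall u : R, 0 <= u <= t -> is_derive u 1 H (r * expR (r * u) * g u)) ->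
  \int[lebesgue_measure]_(s in `[0, t]) (r * expR (- r * s) * f (t - s)) =
  expR (- r * t) * (H t - H 0).
Proof.
move=> t0 cg fg dH.
pose F (s : R) := - (expR (- r * t) * H (t - s)).
transitivity (\int[lebesgue_measure]_(s in `[0, t]) (r * expR (- r * s) * g (t - s))).
  by apply: eq_Rintegral => s; rewrite inE/= in_itv/= => /andP[s0 st]; rewrite fg// subr_ge0.
transitivity (F t - F 0); last by rewrite /F subrr subr0; ring.
apply: (@Rintegral_FTC2 (fun s : R => r * expR (- r * s) * g (t - s)) F t t0).
- exact: exp_kernel_continuous.
- move=> s /andP[s0 st].
  have dHs : is_derive (t - s) 1 H (r * expR (r * (t - s)) * g (t - s)).
    by apply: dH; rewrite subr_ge0 st lerBlDr lerDl.
  have -> : F = (- expR (- r * t)) \*: (fun s => H (t - s)).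
    by apply/funext => x; rewrite /F -mulNr.
  have -> : r * expR (- r * s) * g (t - s) =
      (- expR (- r * t)) *: - (r * expR (r * (t - s)) * g (t - s)).
    rewrite /GRing.scale/= mulrNN.
    have -> : expR (- r * s) = expR (- r * t) * expR (r * (t - s)).
      by rewrite -expRD; congr expR; ring.
    by ring.
  by apply: is_deriveZ; exact: is_derive_reflect.
Qed.

(** Transition probabilities matter for nonnegative times only, and the recursion
    that defines them gives no useful value at negative times. *)
Definition continuous_ge0 f := exists2 g : R -> R, continuous g &
  forall u : R, 0 <= u -> f u = g u.

Lemma continuous_maxr0 : continuous (fun x : R => Num.max x 0).
Proof.
by move=> x; apply: (@continuous_max R R id (cst 0)); [exact: cvg_id|exact: cvg_cst].
Qed.

(** The antiderivative starts at -1 so that it is differentiable at 0. *)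
Lemma exp_conv_continuous r f : continuous_ge0 f -> continuous_ge0
  (fun t => \int[lebesgue_measure]_(s in `[0, t]) (r * expR (- r * s) * f (t - s))).
Proof.
case=> g cg fg.
pose h (u : R) := r * expR (r * u) * g u.
have ch : continuous h.
  move=> x; apply: cvgM; last exact: cg.
  apply: cvgM; first exact: cvg_cst.
  exact: exp_linear_continuous.
pose H (x : R) := \int[lebesgue_measure]_(s in `[-1, x]) h s.
have dH (u : R) : 0 <= u -> is_derive u 1 H (h u).
  move=> u0; have := @continuous_FTC1_closed R h (-1) u (u + 1).
  rewrite ltrDl ltr01 => /(_ isT) [].
  - apply: continuous_compact_integrable; first exact: segment_compact.
    exact: continuous_subspaceT.
  - by rewrite (lt_le_trans _ u0)// ltrN10.
  - exact: ch.
  - by move=> d1 d2; split; [exact: d1|rewrite -derive1E; exact: d2].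
exists (fun t : R => expR (- r * t) * (H (Num.max t 0) - H 0)).
  move=> x; apply: cvgM.
    exact: exp_linear_continuous.
  apply: cvgB; last exact: cvg_cst.
  apply: (@continuous_comp _ _ _ (fun x : R => Num.max x 0) H).
    exact: continuous_maxr0.
  by apply: is_derive1_continuous; apply: dH; rewrite le_max lexx orbT.
move=> t t0; rewrite max_l//; apply: (exp_conv_FTC (H := H) t0 cg fg).
by move=> u /andP[u0 _]; exact: dH.
Qed.

End ExponentialConvolution.

Section DeathProcess.
Context {R : realType}.
Implicit Types (rate f : nat -> R) (k j : nat) (t : R).

Lemma death_prob_eq0 rate k j t : (k < j)%N -> death_prob rate k j t = 0.
Proof.
elim: k j t => [|k IH] j t /= kj; first by case: j kj.
rewrite gtn_eqF// /Rintegral integral0_eq// => s _.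
by rewrite IH ?mulr0//; apply: ltnW.
Qed.

(** Both branches of the definition in one formula: from k the process never
    reaches k + 1, so the integral vanishes when the target is the start. *)
Lemma death_probS rate k j t : death_prob rate k.+1 j t =
  (j == k.+1)%:R * expR (- rate k.+1 * t) +
  \int[lebesgue_measure]_(s in `[0, t])
     (rate k.+1 * expR (- rate k.+1 * s) * death_prob rate k j (t - s)).
Proof.
rewrite /=; case: eqVneq => [->|_]; last by rewrite mul0r add0r.
rewrite mul1r /Rintegral integral0_eq ?addr0//.
by move=> s _; rewrite death_prob_eq0 ?mulr0.
Qed.

Lemma death_prob_continuous rate k j : continuous_ge0 (death_prob rate k j).
Proof.
elim: k => [|k [g cg gE]].
  by exists (fun=> (j == 0)%:R) => // x; exact: cvg_cst.
have [//|h ch hE] := @exp_conv_continuous _ (rate k.+1) (death_prob rate k j).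
  by exists g.
exists (fun t : R => (j == k.+1)%:R * expR (- rate k.+1 * t) + h t).
  move=> x; apply: cvgD; last exact: ch.
  apply: cvgM; first exact: cvg_cst.
  exact: exp_linear_continuous.
by move=> t t0; rewrite death_probS hE.
Qed.

Lemma death_prob_ge0 rate k j t : (forall i, 0 <= rate i) -> 0 <= death_prob rate k j t.
Proof.
move=> rate0; elim: k t => [|k IH] t /=; first by [].
case: ifP => _; first exact: expR_ge0.
by apply: Rintegral_ge0 => s _; rewrite !mulr_ge0 ?expR_ge0.
Qed.

Lemma Rintegral_lincomb d (T : measurableType d) (mu : {measure set T -> \bar R})
  (D : set T) (n : nat) (F : 'I_n -> T -> R) (c : 'I_n -> R) : measurable D ->
  (forall i, mu.-integrable D (EFin \o F i)) ->
  \int[mu]_(x in D) (\sum_(i < n) F i x * c i) =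
  \sum_(i < n) (\int[mu]_(x in D) F i x) * c i.
Proof.
move=> mD; elim: n F c => [|n IH] F c iF.
  rewrite big_ord0; under eq_Rintegral do rewrite big_ord0.
  by rewrite Rintegral_cst// mul0r.
under eq_Rintegral do rewrite big_ord_recr/=.
rewrite RintegralD//=.
- by rewrite big_ord_recr/= RintegralZr// IH.
- have : mu.-integrable D (fun x => \sum_(i < n)
      ((F (widen_ord (leqnSn n) i) x * c (widen_ord (leqnSn n) i))%:E))%E.
    apply: integrable_sum => //= i _.
    by have := integrableZr mD (c (widen_ord (leqnSn n) i)) (iF (widen_ord (leqnSn n) i)).
  by apply: eq_integrable => // x _; rewrite /= sumEFin.
- exact: (integrableZr mD (c ord_max) (iF ord_max)).
Qed.

(** A right eigenfunction of the generator is an eigenfunction of the transition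
    semigroup. *)
Lemma death_prob_eigen rate f beta K k t : (k < K)%N -> 0 <= t ->
  beta * f 0%N = 0 ->
  (forall i, (i < k)%N -> rate i.+1 * (f i - f i.+1) = - beta * f i.+1) ->
  \sum_(j < K) death_prob rate k j t * f j = expR (- beta * t) * f k.
Proof.
move=> kK t0 b0; elim: k kK t t0 => [|k IH] kK t t0 hf.
  rewrite (bigD1 (Ordinal kK))//= mul1r big1 ?addr0; last first.
    by move=> j j0; rewrite /= -[(j : nat) == 0%N]/(j == Ordinal kK) (negbTE j0) mul0r.
  have [f0|bn] := eqVneq (f 0%N) 0; first by rewrite f0 mulr0.
  by move/eqP: b0; rewrite mulf_eq0 (negbTE bn) orbF => /eqP ->; rewrite oppr0 mul0r expR0 mul1r.
set r := rate k.+1.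
under eq_bigr do rewrite death_probS mulrDl.
rewrite big_split/= (bigD1 (Ordinal kK))//= eqxx mul1r big1 ?addr0; last first.
  by move=> j j0; rewrite -[(j : nat) == k.+1]/(j == Ordinal kK) (negbTE j0) !mul0r.
rewrite -(@Rintegral_lincomb _ _ lebesgue_measure `[0, t] K
   (fun (j : 'I_K) (s : R) => r * expR (- r * s) * death_prob rate k j (t - s)) (fun j : 'I_K => f j))//; last first.
  move=> j; have [g cg gE] := death_prob_continuous rate k j.
  suff : lebesgue_measure.-integrable `[0, t] (EFin \o (fun s : R => r * expR (- r * s) * g (t - s))).
    apply: eq_integrable => // s.
    by rewrite inE/= in_itv/= => /andP[s0 st]; rewrite gE// subr_ge0.
  apply: continuous_compact_integrable; first exact: segment_compact.
  exact/continuous_subspaceT/exp_kernel_continuous.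
rewrite (_ : \int[_]_(_ in _) _ = \int[lebesgue_measure]_(s in `[0, t])
   (r * expR (- r * s) * (fun u : R => expR (- beta * u) * f k) (t - s))); last first.
  apply: eq_Rintegral => s; rewrite inE/= in_itv/= => /andP[s0 st].
  rewrite -IH ?subr_ge0//; [|exact: ltnW|by move=> i ik; apply: hf; apply: ltnW].
  by rewrite mulr_sumr; apply: eq_bigr => j _; rewrite mulrA.
have rf : r * f k = (r - beta) * f k.+1.
  by have := hf k (ltnSn k); rewrite -/r mulrBr => /eqP; rewrite subr_eq => /eqP ->; ring.
have E (s : R) : r * expR (r * s) * (expR (- beta * s) * f k) =
    f k.+1 *: ((r - beta) *: expR ((r - beta) * s)).
  have -> : expR ((r - beta) * s) = expR (r * s) * expR (- beta * s).
    by rewrite -expRD; congr expR; ring.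
  rewrite /GRing.scale/=.
  transitivity ((r * f k) * (expR (r * s) * expR (- beta * s))); first by ring.
  by rewrite rf; ring.
pose H : R -> R := f k.+1 \*: (fun u : R => expR ((r - beta) * u)).
have -> : \int[lebesgue_measure]_(s in `[0, t])
   (r * expR (- r * s) * (fun u : R => expR (- beta * u) * f k) (t - s)) =
   expR (- r * t) * (H t - H 0).
  apply: (@exp_conv_FTC _ r (fun u : R => expR (- beta * u) * f k)
    (fun u : R => expR (- beta * u) * f k)) => //.
  - move=> x; apply: cvgM; last exact: cvg_cst.
    exact: exp_linear_continuous.
  - move=> u _; rewrite E; apply: is_deriveZ.
    have -> : (fun u : R => expR ((r - beta) * u)) = expR \o ((r - beta) \*: id).
      by apply/funext.
    rewrite /GRing.scale/= mulrC; apply: is_derive1_comp.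
    by rewrite -[X in is_derive _ _ _ X]mulr1; apply: is_deriveZ.
have <- : expR (- r * t) * expR ((r - beta) * t) = expR (- beta * t).
  by rewrite -expRD; congr expR; ring.
by rewrite /H /= /GRing.scale/= mulr0 expR0; ring.
Qed.

(** Above level j the death rate is constant, so the number of deaths is Poisson
    until j is left. *)
Lemma death_prob_poisson rate (y : R) j d t : 0 <= t ->
  (0 < j)%N -> (forall i, (j <= i)%N -> rate i = y) ->
  death_prob rate (j + d) j t = expR (- y * t) * (y * t) ^+ d / d`!%:R.
Proof.
move=> t0 j0 hr; elim: d t t0 => [|d IH] t t0.
  by rewrite addn0 -(prednK j0) /= eqxx prednK// hr// expr0 fact0 divr1 mulr1.
rewrite addnS death_probS ltn_eqF ?mul0r ?add0r; last by rewrite ltnS leq_addr.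
rewrite hr; last by rewrite -addnS leq_addr.
pose H : R -> R := (d.+1)`!%:R^-1 \*: (fun u : R => (y * u) ^+ d.+1).
transitivity (expR (- y * t) * (H t - H 0)); last first.
  by rewrite /H /= /GRing.scale/= mulr0 expr0n/= mulr0 subr0; ring.
apply: (@exp_conv_FTC _ y _ (fun u : R => expR (- y * u) * (y * u) ^+ d / d`!%:R)) => //.
- move=> x; apply: cvgM; last exact: cvg_cst.
  apply: cvgM.
    exact: exp_linear_continuous.
  apply: (@continuous_comp _ _ _ (fun u : R => y * u) (fun u : R => u ^+ d)); last exact: exprn_continuous.
  by apply: cvgM; [exact: cvg_cst|exact: cvg_id].
- move=> u _.
  have -> : y * expR (y * u) * (expR (- y * u) * (y * u) ^+ d / d`!%:R) =
      (d.+1)`!%:R^-1 *: ((d.+1%:R * (y * u) ^+ d) *: (y *: 1)).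
    rewrite /GRing.scale/= mulr1 factS natrM.
    have e1 : expR (y * u) * expR (- y * u) = 1 by rewrite -expRD mulNr subrr expR0.
    transitivity (y * (expR (y * u) * expR (- y * u)) * (y * u) ^+ d / d`!%:R).
      by ring.
    rewrite e1; field.
    by rewrite addrC natr1 !pnatr_eq0 -lt0n fact_gt0.
  apply: is_deriveZ.
  have -> : (fun u : R => (y * u) ^+ d.+1) = (y \*: id : R -> R) ^+ d.+1.
    by apply/funext => x; rewrite fctE.
  exact: (@is_deriveX _ _ (y \*: id) d.+1 u 1 (y *: 1)).
Qed.

End DeathProcess.

(** * The law of the number of potential departures during an interarrival time *)

Section NonnegativeSeries.
Context {R : realType}.
Implicit Types (a : nat -> R) (l : R).

Lemma eseries_EFin a l : series a @ \oo --> l ->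
  (\sum_(k <oo) (a k)%:E = l%:E)%E.
Proof.
move=> al; apply: cvg_lim => //.
under eq_fun do rewrite sumEFin.
by apply: cvg_EFin; [exact: nearW|exact: al].
Qed.

Lemma series_cvg_of_eseries a l : (forall k, 0 <= a k) ->
  (\sum_(k <oo) (a k)%:E = l%:E)%E -> series a @ \oo --> l.
Proof.
move=> a0 al.
have : (fun n => \sum_(0 <= k < n) (a k)%:E)%E @ \oo --> l%:E.
  by rewrite -al; apply: is_cvg_nneseries => k _ _; rewrite lee_fin.
under eq_fun do rewrite sumEFin.
by move=> /fine_cvg.
Qed.

End NonnegativeSeries.

Definition poisson (R : realType) (y : R) (i : nat) (x : R) : R :=
  expR (- y * x) * (y * x) ^+ i / i`!%:R.

Definition arrival_law (R : realType) (A : cumulativeBounded (0 : R) (1 : R))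
    (y : R) (i : nat) : R := fine (intA A (poisson y i)).

Section Poisson.
Context {R : realType}.
Implicit Types (y x z : R).

Lemma poisson_ge0 y i x : 0 <= y -> 0 <= x -> 0 <= poisson y i x.
Proof.
by move=> y0 x0; rewrite /poisson !mulr_ge0 ?expR_ge0 ?exprn_ge0 ?invr_ge0 ?mulr_ge0.
Qed.

Lemma poisson_continuous y i : continuous (poisson y i).
Proof.
move=> x; apply: cvgM; last exact: cvg_cst.
apply: cvgM; first exact: exp_linear_continuous.
apply: (@continuous_comp _ _ _ (fun u : R => y * u) (fun u : R => u ^+ i)).
  by apply: cvgM; [exact: cvg_cst|exact: cvg_id].
exact: exprn_continuous.
Qed.

Lemma poisson_series y z x :
  series (fun i => z ^+ i * poisson y i x) @ \oo --> expR (- (y - y * z) * x).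
Proof.
have -> : series (fun i => z ^+ i * poisson y i x) =
    (fun n => expR (- y * x) * series (exp_coeff (y * z * x)) n).
  apply/funext => n; rewrite !seriesE mulr_sumr; apply: eq_bigr => i _.
  by rewrite /poisson /exp_coeff/= !exprMn; ring.
have -> : - (y - y * z) * x = - y * x + y * z * x by ring.
rewrite expRD; apply: cvgM; first exact: cvg_cst.
exact: is_cvg_series_exp_coeff.
Qed.

Lemma poisson_factorial_moment y l x :
  series (fun i => 'C(i, l)%:R * poisson y i x) @ \oo --> (y * x) ^+ l / l`!%:R.
Proof.
have s1 : series (fun i => poisson y i x) @ \oo --> (1 : R).
  have := @poisson_series y 1 x; rewrite mulr1 subrr oppr0 mul0r expR0.
  by under eq_fun do rewrite expr1n mul1r.
rewrite -(cvg_shiftn l).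
have -> : (fun n => series (fun i => 'C(i, l)%:R * poisson y i x) (n + l)%N) =
    (fun n => (y * x) ^+ l / l`!%:R * series (fun i => poisson y i x) n).
  apply/funext => n; rewrite !seriesE addnC big_split_ord/= big1 ?add0r; last first.
    by move=> i _; rewrite bin_small ?mul0r.
  rewrite mulr_sumr; apply: eq_bigr => i _.
  rewrite /poisson exprD.
  have := bin_fact (leq_addr i l); rewrite addKn => /(congr1 (fun n : nat => n%:R : R)).
  rewrite !natrM => e.
  have f0 k : (k`!)%:R != 0 :> R by rewrite pnatr_eq0 -lt0n fact_gt0.
  have -> : 'C(l + i, l)%:R = (l + i)`!%:R / (l`!%:R * i`!%:R) :> R.
    by rewrite -e mulfK// mulf_neq0.
  by field; rewrite !f0.
set c := _ / _.
suff : (fun n => c * series (fun i => poisson y i x) n) @ \oo --> c * 1 by rewrite mulr1.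
by apply: cvgM => //; exact: cvg_cst.
Qed.

End Poisson.

Section InterarrivalLaw.
Context {R : realType}.
Variable (A : cumulativeBounded (0 : R) (1 : R)).
Hypothesis (hA : nonneg_cdf A).

Let nu : {measure set (measurableTypeR R) -> \bar R} := lebesgue_stieltjes_measure A.
Let D : set (measurableTypeR R) := `[0%R, +oo[%classic.
Let mD : measurable D. Proof. exact: measurable_itv. Qed.
Let DE x : D x -> 0 <= x. Proof. by rewrite /D/= in_itv/= andbT. Qed.

Lemma measurable_continuous_ge0 (f : R -> R) : continuous_ge0 f ->
  measurable_fun D (EFin \o f).
Proof.
case=> g cg fg; apply/measurable_EFinP.
apply: (@eq_measurable_fun _ _ _ _ D g).
  by move=> x; rewrite inE => /DE x0; rewrite fg.
by apply: measurable_funTS; exact: continuous_measurable_fun.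
Qed.

Lemma mass_half_line : nu D = 1%E.
Proof.
have nuT : nu setT = 1%E by exact: (@probability_setT _ _ _ (lebesgue_stieltjes_measure A)).
have nuN : nu (~` D) = 0%E.
  (* Half-open intervals on which A is constantly 0 cover the negative reals. *)
  have -> : ~` D = \bigcup_n `]- n%:R, - n.+1%:R^-1]%classic.
    apply/seteqP; split => x /=.
      rewrite /D/= in_itv/= andbT => /negP; rewrite -ltNge => x0.
      exists (Num.truncn (- x) + Num.truncn (- x)^-1).+1 => //=; rewrite in_itv/=; apply/andP; split.
        rewrite ltrNl (lt_le_trans (truncnS_gt _))// ler_nat.
        by rewrite ltnS leq_addr.
      rewrite lerNr -[leRHS]invrK lef_pV2 ?posrE ?invr_gt0 ?oppr_gt0//.
      by rewrite (le_trans (ltW (truncnS_gt _)))// ler_nat ltnS leqW// leq_addl.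
    case=> n _; rewrite /D/= !in_itv/= andbT => /andP[_ xn]; apply/negP; rewrite -ltNge.
    by rewrite (le_lt_trans xn)// oppr_lt0 invr_gt0.
  apply: measure_negligible; first exact: bigcup_measurable.
  apply: negligible_bigcup => n; apply/negligibleP => //.
  rewrite /nu/= /lebesgue_stieltjes_measure /measure_extension.
  rewrite measurable_mu_extE/=; last exact: is_ocitv.
  have nn : - n%:R <= - n.+1%:R^-1 :> R \/ - n.+1%:R^-1 < - n%:R :> R.
    by case: (leP (- n%:R : R) (- n.+1%:R^-1)); [left|right].
  case: nn => [nn|nn]; last first.
    rewrite (_ : `]_, _]%classic = set0) ?wlength0//.
    apply/seteqP; split => // x /=; rewrite in_itv/= => /andP[h1 h2].
    by have := lt_trans (lt_le_trans h1 h2) nn; rewrite ltxx.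
  have a1 : - n.+1%:R^-1 < 0 :> R by rewrite oppr_lt0 invr_gt0.
  by rewrite wlength_itv_bnd// (hA a1) (hA (le_lt_trans nn a1)) -?EFinB ?subrr ?subee.
have : nu (D `|` ~` D) = (nu D + nu (~` D))%E.
  by rewrite measureU//; [exact: measurableC|rewrite setICr].
by rewrite setUv nuT nuN adde0.
Qed.

Lemma integrable_continuous_ge0 (f : R -> R) : continuous_ge0 f ->
  (forall x, 0 <= x -> 0 <= f x <= 1) -> nu.-integrable D (EFin \o f).
Proof.
move=> cf f01; apply: (@le_integrable _ _ _ nu D mD _ (EFin \o cst (1 : R))).
- exact: measurable_continuous_ge0.
- move=> x /DE x0; have /andP[f0 f1] := f01 x x0.
  by rewrite /= lee_fin normr1 ger0_norm.
- exact: (@finite_measure_integrable_cst _ _ _ nu).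
Qed.

Lemma continuous_ge0W (f : R -> R) : continuous f -> continuous_ge0 f.
Proof. by move=> cf; exists f. Qed.

Lemma laplace_fin s : 0 <= s -> laplace A s = (alpha A s)%:E.
Proof.
move=> s0; rewrite /alpha fineK//; apply: (@integrable_fin_num _ _ _ nu D) => //.
apply: integrable_continuous_ge0.
  by apply: continuous_ge0W; exact: exp_linear_continuous.
move=> x x0; rewrite expR_ge0/= -expR0 ler_expR mulNr oppr_le0.
exact: mulr_ge0.
Qed.

Section WithRate.
Variable y : R.
Hypothesis y0 : 0 < y.

Let r := arrival_law A y.

Lemma poisson_le1 i x : 0 <= x -> poisson y i x <= 1.
Proof.
move=> x0.
have := @poisson_series R y 1 x; rewrite mulr1 subrr oppr0 mul0r expR0.
under eq_fun do rewrite expr1n mul1r.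
move=> /(series_le_lim i.+1) => /(_ (fun k => poisson_ge0 k (ltW y0) x0)).
rewrite seriesSr; apply: le_trans; rewrite lerDr seriesE sumr_ge0// => k _.
exact: poisson_ge0 (ltW y0) x0.
Qed.

Lemma intA_poisson i : intA A (poisson y i) = (r i)%:E.
Proof.
rewrite /r /arrival_law fineK//; apply: (@integrable_fin_num _ _ _ nu D) => //.
apply: integrable_continuous_ge0.
  by apply: continuous_ge0W; exact: poisson_continuous.
by move=> x x0; rewrite poisson_ge0 ?(ltW y0)// poisson_le1.
Qed.

Lemma arrival_law_ge0 i : 0 <= r i.
Proof.
rewrite -lee_fin -intA_poisson; apply: integral_ge0 => x /DE x0.
by rewrite lee_fin poisson_ge0// ltW.
Qed.

(** Mixing over the interarrival time by monotone convergence: an identity for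
    Poisson laws, with nonnegative coefficients c, integrates to one for r. *)
Lemma arrival_law_series (c : nat -> R) (F : R -> R) (l : R) :
  (forall i, 0 <= c i) ->
  (forall x, 0 <= x -> series (fun i => c i * poisson y i x) @ \oo --> F x) ->
  intA A F = l%:E -> series (fun i => c i * r i) @ \oo --> l.
Proof.
move=> c0 cF Fl; apply: series_cvg_of_eseries.
  by move=> k; rewrite mulr_ge0// arrival_law_ge0.
rewrite -Fl /intA.
have -> : (\int[nu]_(x in D) (F x)%:E =
    \int[nu]_(x in D) \sum_(i <oo) (c i * poisson y i x)%:E)%E.
  apply: eq_integral => x; rewrite inE => /DE x0.
  by apply/esym/eseries_EFin; exact: cF.
have cc i : continuous (fun x => c i * poisson y i x).
  by move=> x; apply: cvgM; [exact: cvg_cst|exact: poisson_continuous].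
rewrite integral_nneseries//.
- apply: eq_eseriesr => i _; rewrite EFinM -intA_poisson /intA.
  rewrite -ge0_integralZl_EFin//.
  + by move=> x /DE x0; rewrite lee_fin poisson_ge0// ltW.
  + by apply: measurable_continuous_ge0; apply: continuous_ge0W; exact: poisson_continuous.
- by move=> i; apply: measurable_continuous_ge0; apply: continuous_ge0W.
- by move=> i x /DE x0; rewrite lee_fin mulr_ge0// poisson_ge0// ltW.
Qed.

Lemma arrival_law_pgf z : 0 <= z <= 1 ->
  series (fun i => r i * z ^+ i) @ \oo --> alpha A (y - y * z).
Proof.
case/andP=> z0 z1.
under eq_fun do rewrite mulrC.
apply: (@arrival_law_series _ (fun x => expR (- (y - y * z) * x))) => [i|x _|].
- exact: exprn_ge0.
- exact: poisson_series.
- by rewrite -laplace_fin// subr_ge0 ler_piMr// ltW.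
Qed.

Lemma arrival_law_sum : series r @ \oo --> (1 : R).
Proof.
have := @arrival_law_pgf 1; rewrite ler01 lexx mulr1 subrr => /(_ isT).
under eq_fun do rewrite expr1n mulr1.
suff -> : alpha A 0 = 1 by [].
rewrite /alpha /laplace /intA.
under eq_integral do rewrite oppr0 mul0r expR0.
by rewrite integral_cst// mul1e -/nu mass_half_line.
Qed.

Lemma arrival_law_factorial_moment l (M : R) :
  intA A (fun x => (y * x) ^+ l) = M%:E ->
  series (fun i => 'C(i, l)%:R * r i) @ \oo --> M / l`!%:R.
Proof.
move=> hM; apply: (@arrival_law_series _ (fun x => (y * x) ^+ l / l`!%:R)) => [i|x _|].
- exact: ler0n.
- exact: poisson_factorial_moment.
- have cl : continuous (fun x : R => (y * x) ^+ l).
    move=> x; apply: (@continuous_comp _ _ _ (fun u : R => y * u) (fun u : R => u ^+ l)).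
      by apply: cvgM; [exact: cvg_cst|exact: cvg_id].
    exact: exprn_continuous.
  rewrite /intA; under eq_integral do rewrite mulrC EFinM.
  rewrite ge0_integralZl_EFin//.
  + by rewrite mulrC EFinM -hM.
  + by move=> x /DE x0; rewrite lee_fin exprn_ge0// mulr_ge0// ltW.
  + by apply: measurable_continuous_ge0; exact: continuous_ge0W.
Qed.

(** If r_i = 0 then the Poisson weight vanishes almost everywhere, hence so does
    the interarrival time, which contradicts its positive mean. *)
Lemma arrival_law_gt0 i : intA A (fun x => x) != 0%E -> 0 < r i.
Proof.
move=> mean0; rewrite lt_neqAle arrival_law_ge0 andbT; apply/eqP => ri.
have mp : measurable_fun D (EFin \o poisson y i).
  by apply: measurable_continuous_ge0; apply: continuous_ge0W; exact: poisson_continuous.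
have mi : measurable_fun D (EFin \o (id : R -> R)).
  by apply: measurable_continuous_ge0; apply: continuous_ge0W => x; exact: cvg_id.
have : (\int[nu]_(x in D) `|(EFin \o poisson y i) x| = 0)%E.
  transitivity (intA A (poisson y i)); last by rewrite intA_poisson -ri.
  apply: eq_integral => x.
  by rewrite inE => /DE x0; rewrite /= ger0_norm// poisson_ge0// ltW.
move=> /(ae_eq_integral_abs nu mD mp).1 [N [mN N0 subN]].
move/eqP: mean0; apply.
rewrite /intA (@ae_eq_integral _ _ _ nu D (cst 0%E))//; first by rewrite integral_cst// mul0e.
exists N; split => // x /= nx; apply: subN => /= px; apply: nx => Dx.
have x0 := DE Dx; move: (px Dx) => /= [].
have [->//|xn] := eqVneq x 0.
have : 0 < poisson y i x.
  by rewrite /poisson divr_gt0 ?ltr0n ?fact_gt0// mulr_gt0 ?expR_gt0// exprn_gt0// mulr_gt0// lt_neqAle eq_sym xn.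
by move=> /[swap] ->; rewrite ltxx.
Qed.

End WithRate.

End InterarrivalLaw.

(** * The generating function R and the roots of R(z) = z *)

Lemma cvg_bigsum (R : realType) (T : Type) (F : set_system T) (I : eqType)
    (s : seq I) (f : I -> T -> R) (l : I -> R) : Filter F ->
  (forall i, i \in s -> f i x @[x --> F] --> l i) ->
  (fun x => \sum_(i <- s) f i x) @ F --> \sum_(i <- s) l i.
Proof.
move=> FF; elim: s => [|i s IH] fl.
  by rewrite big_nil; under eq_fun do rewrite big_nil; exact: cvg_cst.
rewrite big_cons; under eq_fun do rewrite big_cons.
apply: cvgD; first by apply: fl; rewrite mem_head.
by apply: IH => j js; apply: fl; rewrite in_cons js orbT.
Qed.

Section PowerSeries.
Context {R : realType}.
Implicit Types (f : nat -> R) (K L x : R).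

(** (n + 1) x^n is at most 1 + x + ... + x^n. *)
Lemma geometric_polynomial_bound x n : 0 <= x < 1 -> n.+1%:R * x ^+ n <= (1 - x)^-1.
Proof.
case/andP=> x0 x1.
have p1 : 0 < 1 - x by rewrite subr_gt0.
rewrite -[leRHS]mul1r ler_pdivlMr//.
apply: (@le_trans _ _ ((\sum_(i < n.+1) x ^+ i) * (1 - x))).
  rewrite ler_wpM2r// ?(ltW p1)//.
  have -> : n.+1%:R * x ^+ n = \sum_(i < n.+1) x ^+ n by rewrite sumr_const card_ord mulr_natl.
  by apply: ler_sum => i _; rewrite ler_wiXn2l// ?(ltW x1)// leq_ord.
have -> : (\sum_(i < n.+1) x ^+ i) * (1 - x) = 1 - x ^+ n.+1.
  by rewrite -[RHS]opprB subrX1 -mulNr opprB mulrC.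
by rewrite gerBl exprn_ge0.
Qed.

Lemma pseries_diffs_cvg f K L : (forall i, 0 <= f i) -> 0 < K -> K < L ->
  cvgn (pseries f L) -> cvgn (pseries (pseries_diffs f) K).
Proof.
move=> f0 K0 KL cL; have L0 := lt_trans K0 KL.
pose q := K / L.
have q01 : 0 <= q < 1 by rewrite divr_ge0 ?ltW//= ltr_pdivrMr// mul1r.
have q1 : 0 < 1 - q by rewrite subr_gt0; case/andP: q01.
pose c := L^-1 * (1 - q)^-1.
have c0 : 0 <= c by rewrite mulr_ge0// invr_ge0 ltW.
apply: (@series_le_cvg _ _ (fun i => c * (f i.+1 * L ^+ i.+1))).
- by move=> i; apply: mulr_ge0; [exact: mulr_ge0|rewrite exprn_ge0// ltW].
- by move=> i; rewrite mulr_ge0// mulr_ge0// exprn_ge0// ltW.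
- move=> i; rewrite /pseries_diffs /=.
  have -> : i.+1%:R * f i.+1 * K ^+ i = (i.+1%:R * q ^+ i) * (f i.+1 * L ^+ i).
    by rewrite /q expr_div_n; field; rewrite expf_neq0 ?lt0r_neq0.
  have -> : c * (f i.+1 * L ^+ i.+1) = (1 - q)^-1 * (f i.+1 * L ^+ i).
    by rewrite /c exprS; field; rewrite !lt0r_neq0.
  rewrite ler_wpM2r ?geometric_polynomial_bound//.
  by rewrite mulr_ge0// exprn_ge0// ltW.
- have -> : series (fun i => c * (f i.+1 * L ^+ i.+1)) =
      (fun n => c * (pseries f L n.+1 - f 0%N)).
    apply/funext => n; rewrite /pseries !seriesE big_ord_recl /= expr0 mulr1.
    by rewrite addrC addKr mulr_sumr.
  move/cvg_ex: cL => [l hl]; apply/cvg_ex; exists (c * (l - f 0%N)).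
  apply: cvgM; first exact: cvg_cst.
  apply: cvgB; last exact: cvg_cst.
  by rewrite cvg_shiftS.
Qed.

Lemma pseries_is_derive f x : (forall i, 0 <= f i) -> cvgn (pseries f 1) ->
  0 <= x < 1 ->
  is_derive x 1 (fun x => limn (pseries f x)) (limn (pseries (pseries_diffs f) x)).
Proof.
move=> f0 c1 /andP[x0 x1].
(* Each differentiation of the series costs a smaller radius: four radii between
   x and 1. *)
pose K k := x + (1 - x) * (k.+1%:R / 4).
have Klt k l : (k < l)%N -> K k < K l.
  move=> kl; rewrite ltrD2l ltr_pM2l ?subr_gt0// ltr_pM2r ?invr_gt0//.
  by rewrite ltr_nat ltnS.
have K3 : K 3%N = 1 by rewrite /K divff ?mulr1 ?pnatr_eq0//; ring.
have K0 k : 0 < K k.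
  by rewrite ltr_wpDl// mulr_gt0 ?subr_gt0// divr_gt0.
have d0 : forall i, 0 <= pseries_diffs f i by move=> i; rewrite mulr_ge0.
have dd0 : forall i, 0 <= pseries_diffs (pseries_diffs f) i by move=> i; rewrite mulr_ge0.
have cK2 : cvgn (pseries (pseries_diffs f) (K 2)).
  by apply: (pseries_diffs_cvg f0 (K0 2%N) _ c1); rewrite -K3 Klt.
have cK1 : cvgn (pseries (pseries_diffs (pseries_diffs f)) (K 1)).
  by apply: (pseries_diffs_cvg d0 (K0 1%N) _ cK2); rewrite Klt.
have ltN a b : 0 < a -> a < b -> `|a| < `|b|.
  by move=> a0 ab; rewrite !gtr0_norm// (lt_trans a0).
apply: (@pseries_snd_diffs _ f (K 0%N)).
- by apply: is_cvg_pseries_inside c1 _; rewrite ltN// -K3 Klt.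
- by apply: is_cvg_pseries_inside cK2 _; rewrite ltN// Klt.
- by apply: is_cvg_pseries_inside cK1 _; rewrite ltN// Klt.
- by rewrite ger0_norm// gtr0_norm// ltrDl mulr_gt0 ?subr_gt0// divr_gt0.
Qed.

End PowerSeries.

Section Roots.
Context {R : realType}.
Variable (A : cumulativeBounded (0 : R) (1 : R)).
Hypothesis (hA : nonneg_cdf A) (mean_neq0 : intA A (fun x => x) != 0%E).
Variable y : R.
Hypothesis y0 : 0 < y.

Let r := arrival_law A y.
Let G z := alpha A (y - y * z).

Let r_ge0 i : 0 <= r i. Proof. exact: arrival_law_ge0. Qed.
Let r_gt0 i : 0 < r i. Proof. exact: arrival_law_gt0. Qed.
Let r_pgf z : 0 <= z <= 1 -> series (fun i => r i * z ^+ i) @ \oo --> G z.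
Proof. exact: arrival_law_pgf. Qed.
Let G1 : G 1 = 1.
Proof.
have := @r_pgf 1; rewrite ler01 lexx => /(_ isT).
under eq_fun do rewrite expr1n mulr1.
move=> /(cvg_lim (@Rhausdorff R)) <-.
exact: (cvg_lim (@Rhausdorff R) (arrival_law_sum hA y0)).
Qed.

Lemma pgf_pseries z : 0 <= z <= 1 -> G z = limn (pseries r z).
Proof. by move=> z01; apply/esym/cvg_lim => //; exact: r_pgf. Qed.

Let r_cvg1 : cvgn (pseries r 1).
Proof. by apply/cvg_ex; exists (G 1); apply: r_pgf; rewrite ler01 lexx. Qed.

Lemma pgf_derivative z : 0 < z < 1 ->
  series (fun i => i%:R * (r i * z ^+ i)) @ \oo -->
    - (y * z * derive1 (alpha A) (y - y * z)).
Proof.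
case/andP=> z0 z1.
have := pseries_is_derive r_ge0 r_cvg1 (introT andP (conj (ltW z0) z1)).
set d := limn _ => dP.
have cd : pseries (pseries_diffs r) z @ \oo --> d.
  exact: (pseries_diffs_cvg r_ge0 z0 z1 r_cvg1).
have -> : derive1 (alpha A) (y - y * z) = - (d / y).
  rewrite derive1E.
  pose h s := limn (pseries r (1 - s / y)).
  have near_h : \forall s \near (y - y * z), alpha A s = h s.
    have h1 : y - y * z < y by rewrite ltrBlDr ltrDl mulr_gt0.
    have h0 : 0 < y - y * z by rewrite subr_gt0 gtr_pMr.
    near=> s.
    rewrite /h -pgf_pseries; last first.
      rewrite subr_ge0 ler_pdivrMr// mul1r gerBl divr_ge0 ?(ltW y0) ?andbT//.
        near: s; exact: lt_le_nbhsl.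
      by apply/ltW; near: s; exact: lt_nbhsr.
    by rewrite /G; congr alpha; field; rewrite lt0r_neq0.
  rewrite (near_eq_derive _ near_h) ?oner_eq0//.
  have zE : 1 - (y - y * z) / y = z by field; rewrite lt0r_neq0.
  have dh : is_derive (y - y * z) 1 h (d * (- y^-1)).
    have -> : h = (fun x => limn (pseries r x)) \o (fun s => 1 - s / y) by [].
    apply: is_derive1_comp; first by rewrite zE.
    have -> : (fun s : R => 1 - s / y) = cst 1 - (y^-1 \*: id).
      by apply/funext => s; rewrite /= mulrC.
    rewrite -[X in is_derive _ _ _ X]add0r; apply: is_deriveB.
    by rewrite -[X in is_derive _ _ _ X]mulr1; apply: is_deriveZ.
  by have [_ ->] := dh; rewrite mulrN.
have -> : - (y * z * - (d / y)) = z * d by field; rewrite lt0r_neq0.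
rewrite -cvg_shiftS.
have -> : (fun n => series (fun i => i%:R * (r i * z ^+ i)) n.+1) =
    (fun n => z * pseries (pseries_diffs r) z n).
  apply/funext => n; rewrite /pseries !seriesE big_ord_recl /= mul0r add0r mulr_sumr.
  by apply: eq_bigr => i _; rewrite /bump /= add1n /pseries_diffs exprS; ring.
by apply: cvgM => //; exact: cvg_cst.
Unshelve. all: by end_near. Qed.

Lemma pgf_gt0 z : 0 <= z <= 1 -> 0 < G z.
Proof.
move=> z01; apply: (lt_le_trans (r_gt0 0%N)).
have /andP[z0 _] := z01.
have := partial_sum_le 1 _ (r_pgf z01); rewrite big_ord1 expr0 mulr1; apply.
by move=> i; rewrite mulr_ge0// exprn_ge0.
Qed.

Lemma pgf_lt1 z : 0 <= z < 1 -> G z < 1.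
Proof.
case/andP=> z0 z1.
have c0 : series (fun i => r i - r i * z ^+ i) @ \oo --> 1 - G z.
  have -> : series (fun i => r i - r i * z ^+ i) =
    (fun n => series r n - series (fun i => r i * z ^+ i) n).
    by apply/funext => n; rewrite !seriesE sumrB.
  by apply: cvgB; [exact: arrival_law_sum|apply: r_pgf; rewrite z0 ltW].
rewrite -subr_gt0.
have := partial_sum_le 2 _ c0; rewrite !big_ord_recl big_ord0 expr0 mulr1 subrr add0r addr0.
rewrite expr1 => h; apply: (lt_le_trans _ (h _)).
  by rewrite /bump /= -[X in X - _]mulr1 -mulrBr mulr_gt0// subr_gt0.
by move=> i; rewrite -[X in X - _]mulr1 -mulrBr mulr_ge0// subr_ge0 exprn_ile1// ltW.
Qed.

(** Strict convexity. The divided difference H of R at s has sum 1, because s and 1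
    are both roots, and R'(s) is its sum with weights s^k < 1; its coefficient
    of index 1 is positive since r_2 > 0. *)
Lemma pgf_root_slope (s D : R) : 0 < s < 1 -> G s = s ->
  series (fun i => i%:R * (r i * s ^+ i)) @ \oo --> D -> D / s < 1.
Proof.
case/andP=> s0 s1 Gs hD.
have rs : series (fun i => r i * s ^+ i) @ \oo --> s.
  by rewrite -[X in _ --> X]Gs; apply: r_pgf; rewrite !ltW.
have r1 : series (fun i => r i * 1 ^+ i) @ \oo --> (1 : R).
  by rewrite -[X in _ --> X]G1; apply: r_pgf; rewrite ler01 lexx.
pose h := ddiff r s s.
have h0 k : 0 <= h k by exact: ddiff_ge0.
have hs : series (fun k => h k * s ^+ k) @ \oo --> D / s by exact: ddiff_diag_series.
have h1 : series h @ \oo --> (1 : R).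
  have := ddiff_series r_ge0 s0 ltr01 _ rs r1; rewrite divff ?subr_eq0 ?gt_eqF// => /(_ isT).
  by under eq_fun do rewrite expr1n mulr1.
have hd : series (fun k => h k * (1 - s ^+ k)) @ \oo --> 1 - D / s.
  have -> : series (fun k => h k * (1 - s ^+ k)) =
    (fun n => series h n - series (fun k => h k * s ^+ k) n).
    by apply/funext => n; rewrite !seriesE -sumrB; apply: eq_bigr => k _; rewrite mulrBr mulr1.
  exact: cvgB.
rewrite -subr_gt0.
have := partial_sum_le 2 _ hd; rewrite !big_ord_recl big_ord0 expr0 subrr mulr0 add0r addr0 => hle.
apply: (lt_le_trans _ (hle _)).
  rewrite /bump /= expr1 mulr_gt0 ?subr_gt0// /h /ddiff divr_gt0 ?exprn_gt0// subr_gt0.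
  apply: (@lt_le_trans _ _ (\sum_(i < 3) r i * s ^+ i)).
    by rewrite [ltRHS]big_ord_recr/= ltrDl mulr_gt0// exprn_gt0.
  by apply: (partial_sum_le _ _ rs) => i; rewrite mulr_ge0// exprn_ge0// ltW.
by move=> k; rewrite mulr_ge0// subr_ge0 exprn_ile1// ltW.
Qed.

(** The tails t_k of r satisfy 1 - R(z) = (1 - z) sum t_k z^k with sum t_k > 1, so
    R(z) < z for z slightly below 1, while R(0) = r_0 > 0. *)
Lemma pgf_root_exists (a : R) : series (fun i => i%:R * r i) @ \oo --> a -> 1 < a ->
  exists2 z, 0 < z < 1 & G z = z.
Proof.
move=> ra a1.
pose t := tail r 1.
have t0 k : 0 <= t k by rewrite subr_ge0; apply: partial_sum_le => //; exact: arrival_law_sum.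
have ta : series t @ \oo --> a.
  have -> : t = (fun k => 'C(k, 0)%:R * tail r 1 k).
    by apply/funext => k; rewrite bin0 mul1r.
  apply: tail_binomial_series => //; first exact: arrival_law_sum.
  by under eq_fun do rewrite bin1.
have [N N1] : exists N, 1 < series t N.
  have [N _ hN] : \forall n \near \oo, 1 < series t n by apply: (cvgr_gt a).
  by exists N; apply: hN => /=.
have [z /andP[z0 z1] Gz] : exists2 z, 0 < z < 1 & G z < z.
  (* A partial sum of the tails exceeding 1 is a polynomial, hence exceeds 1 near 1. *)
  pose P (x : R) := \sum_(k < N) t k * x ^+ k.
  have cP : P x @[x --> (1 : R)] --> P 1.
    apply: cvg_bigsum => k _; apply: cvgM; first exact: cvg_cst.
    exact: exprn_continuous.
  have P1 : 1 < P 1.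
    by rewrite /P; under eq_bigr do rewrite expr1n mulr1; rewrite -seriesE.
  have [z [z01 Pz]] : exists z, 0 < z < 1 /\ 1 < P z.
    have nP : \forall z \near (1 : R)^'-, 1 < P z.
      by apply: (cvgr_gt (P 1)) => //; exact: cvg_at_left_filter.
    have near1 : \forall z \near (1 : R)^'-, 0 < z < 1 /\ 1 < P z.
      near=> z; split; last first.
        by near: z; exact: nP.
      apply/andP; split; near: z; first exact: nbhs_left_gt.
      exact: nbhs_left_lt.
    exact: (@filter_ex _ (1 : R)^'- _ _ near1).
  exists z => //; have /andP[z0 z1] := z01.
  have r1 : series (fun i => r i * 1 ^+ i) @ \oo --> (1 : R).
    by rewrite -[X in _ --> X]G1; apply: r_pgf; rewrite ler01 lexx.
  have rz : series (fun i => r i * z ^+ i) @ \oo --> G z by apply: r_pgf; rewrite !ltW.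
  have := ddiff_series r_ge0 ltr01 z0 _ r1 rz; rewrite lt_eqF// => /(_ isT).
  rewrite ddiff1 -/t => hz.
  have : 1 < (G z - 1) / (z - 1).
    apply: (lt_le_trans Pz).
    by apply: (partial_sum_le _ _ hz) => k; rewrite mulr_ge0// exprn_ge0// ltW.
  by rewrite ltr_ndivlMr ?subr_lt0// mul1r ltrD2r.
have cG : {within `[0, z], continuous (fun x => G x - x)}.
  apply: (@subspace_eq_continuous _ _ _ (fun x => limn (pseries r x) - x)).
    move=> x; rewrite inE/= in_itv/= => /andP[x0 xz]; rewrite -pgf_pseries//.
    by rewrite x0 (le_trans xz)// ltW.
  apply/continuous_in_subspaceT => x; rewrite inE/= in_itv/= => /andP[x0 xz].
  apply: cvgB; last exact: cvg_id.
  apply: is_derive1_continuous; apply: pseries_is_derive => //.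
  by rewrite x0 (le_lt_trans xz).
have G0 : 0 < G 0 - 0 by rewrite subr0 pgf_gt0// lexx ler01.
have [|c] := @IVT _ _ _ _ 0 (ltW z0) cG.
  have Gz' : G z - z <= 0 by rewrite subr_le0 ltW.
  by rewrite ge_min le_max Gz' orbT (ltW G0).
rewrite in_itv/= => /andP[c0 cz] /eqP; rewrite subr_eq0 => /eqP Gc.
exists c => //; rewrite (le_lt_trans cz z1) andbT lt_neqAle c0 andbT.
apply/eqP => cE; have G00 : G 0 = 0 by rewrite [in LHS]cE Gc -cE.
by move: G0; rewrite G00 subrr ltxx.
Unshelve. all: by end_near. Qed.

Lemma root_pgf z : 0 <= z <= 1 -> (z%:E = laplace A (y - y * z)) <-> G z = z.
Proof.
case/andP=> z0 z1; rewrite laplace_fin ?subr_ge0 ?ler_piMr ?(ltW y0)//.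
by rewrite -/(G z); split=> [[]|->].
Qed.

(** Every real root is nonnegative, as a value of the Laplace transform. *)
Lemma least_root_pgf (s a : R) : series (fun i => i%:R * r i) @ \oo --> a -> 1 < a ->
  s%:E = laplace A (y - y * s) ->
  (forall z, z%:E = laplace A (y - y * z) -> `|s| <= `|z|) ->
  0 < s < 1 /\ G s = s.
Proof.
move=> ra a1 hs hmin.
have [c /andP[c0 c1] Gc] := pgf_root_exists ra a1.
have sc : `|s| <= c.
  rewrite -[leRHS]gtr0_norm//; apply: hmin; apply/root_pgf => //.
  by rewrite !ltW.
have s1 : s < 1 by rewrite (le_lt_trans (ler_norm _))// (le_lt_trans sc).
have s0 : 0 <= s.
  rewrite -lee_fin hs /laplace; apply: integral_ge0 => x _.
  by rewrite lee_fin expR_ge0.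
have s01 : 0 <= s <= 1 by rewrite s0 ltW.
have Gs : G s = s by apply/(root_pgf s01).
by split => //; rewrite s1 andbT -Gs pgf_gt0.
Qed.

End Roots.

(** * The profile of the stationary law above the level m *)

Definition takacs_incr (R : realType) (r : nat -> R) (k : nat) : R := takacs r k - shift (takacs r) k.

Section BoundaryLayer.
Context {R : realType}.
Implicit Types (r : nat -> R) (z phi : R).

Lemma convC (a b : nat -> R) n : conv a b n = conv b a n.
Proof.
rewrite /conv (reindex_inj rev_ord_inj) /=; apply: eq_bigr => i _.
by rewrite subSS mulrC subKn// leq_ord.
Qed.

Lemma conv_takacs_incr0 r : r 0%N != 0 -> conv r (takacs_incr r) 0 = 1.
Proof.
by move=> r0; rewrite /takacs_incr conv_Br conv_shift conv_takacs//= subr0 addr0.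
Qed.

Lemma conv_takacs_incrS r k : r 0%N != 0 ->
  conv r (takacs_incr r) k.+1 = takacs_incr r k - (k == 0)%:R.
Proof.
move=> r0; rewrite /takacs_incr conv_Br conv_shift /= !conv_takacs//= add0r.
by rewrite opprD addrCA addrC.
Qed.

Lemma takacs_sum_profile r n : r 0%N != 0 ->
  \sum_(k < n.+2) conv r (takacs_incr r) k = takacs r n.
Proof.
move=> r0; elim: n => [|n IH].
  by rewrite big_ord_recr big_ord1 /= conv_takacs_incr0// conv_takacs_incrS// /takacs_incr/= subr0; ring.
by rewrite big_ord_recr /= IH conv_takacs_incrS// /takacs_incr/=; ring.
Qed.

(** The left-hand side has an apparent geometric growth z^-n. In generating
    functions its pole at z is removable, and dividing by x - z leaves the
    divided difference of R at z. As a recursion in n, both sides are multiplied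
    by z^-1 and receive (z^-1 - phi^-1) c_(n+1) at each step. *)
Lemma geometric_profile r z phi n : r 0%N != 0 -> z != 0 -> phi != 0 ->
  (z^-1 - phi^-1) * conv (fun l => z^-1 ^+ l) (conv r (takacs_incr r)) n
    - z^-1 ^+ n * (z^-1 - 1) =
  (n == 0)%:R - takacs_incr r n + z / phi * conv (ddiff r z phi) (takacs_incr r) n.
Proof.
move=> r0 z0 p0; elim: n => [|n IH].
  have e0 := conv_takacs_incr0 r0.
  rewrite [X in _ = _ + X](_ : _ = phi^-1 * (z * conv (ddiff r z phi) (takacs_incr r) 0)); last by ring.
  have e1 : (phi - r 0%N) * takacs_incr r 0 = phi * takacs_incr r 0 - 1.
    by rewrite mulrBl -(conv0 r) e0.
  rewrite conv_ddiff0// [in LHS]conv0 e0 e1 /= expr0.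
  by field; rewrite p0 z0.
rewrite convS expr0 mul1r.
have -> : \sum_(k < n.+1) z^-1 ^+ k.+1 * conv r (takacs_incr r) (n - k) =
    z^-1 * conv (fun l => z^-1 ^+ l) (conv r (takacs_incr r)) n.
  by rewrite /conv mulr_sumr; apply: eq_bigr => k _; rewrite exprS mulrA.
have dS := conv_ddiffS r phi (takacs_incr r) n z0.
rewrite [X in _ = _ + X](_ : _ = phi^-1 * (z * conv (ddiff r z phi) (takacs_incr r) n.+1)); last by ring.
rewrite dS /=.
have -> : (z^-1 - phi^-1) * (conv r (takacs_incr r) n.+1 +
    z^-1 * conv (fun l => z^-1 ^+ l) (conv r (takacs_incr r)) n) - z^-1 ^+ n.+1 * (z^-1 - 1) =
  (z^-1 - phi^-1) * conv r (takacs_incr r) n.+1 + z^-1 *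
  ((z^-1 - phi^-1) * conv (fun l => z^-1 ^+ l) (conv r (takacs_incr r)) n - z^-1 ^+ n * (z^-1 - 1)).
  by rewrite exprS; ring.
rewrite IH conv_takacs_incrS//; set b := (n == 0)%:R.
by field; rewrite p0 z0.
Qed.

End BoundaryLayer.

Section TransitionMatrix.
Context {R : realType}.
Variables (A : cumulativeBounded (0 : R) (1 : R)) (mu : R) (m : nat).
Hypotheses (mu0 : 0 < mu) (hm : (0 < m)%N).

Let rate := service_rate mu m.
Let r := arrival_law A (mu * m%:R).
Let T k j : R := fine (intA A (death_prob rate k j)).

Lemma transition_poisson k j : (m <= j)%N ->
  T k j = if (k < j)%N then 0 else r (k - j)%N.
Proof.
move=> mj; rewrite /T.
case: ltnP => kj.
  rewrite [X in fine X](_ : _ = 0%E)//; apply: integral0_eq => x _.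
  by rewrite death_prob_eq0.
rewrite /r /arrival_law; congr fine.
have dD (x : R) : x \in `[0%R, +oo[%classic -> 0 <= x by rewrite inE/= in_itv/= andbT.
apply: eq_integral => x /dD x0; congr EFin.
rewrite -{1}(subnKC kj) (death_prob_poisson (y := mu * m%:R))//.
- by rewrite (leq_trans hm).
- by move=> i ji; rewrite /rate /service_rate (minn_idPr (leq_trans mj ji)).
Qed.

Lemma service_rate_ge0 i : 0 <= rate i.
Proof. by rewrite /rate /service_rate mulr_ge0// ltW. Qed.

Lemma death_prob_integrable k j :
  (lebesgue_stieltjes_measure A).-integrable `[0%R, +oo[ (EFin \o death_prob rate k j).
Proof.
apply: integrable_continuous_ge0; first exact: death_prob_continuous.
move=> x x0; rewrite death_prob_ge0/=; last exact: service_rate_ge0.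
have [jk|kj] := leqP j k; last by rewrite death_prob_eq0.
have <- : \sum_(i < k.+1) death_prob rate k i x * 1 = 1.
  rewrite (@death_prob_eigen R rate (fun=> 1) 0 k.+1 k x)//.
  - by rewrite oppr0 mul0r expR0 mulr1.
  - by rewrite mul0r.
  - by move=> i _; rewrite subrr mulr0 oppr0 mul0r.
have jk1 : (j < k.+1)%N by [].
rewrite (bigD1 (Ordinal jk1))//= mulr1 lerDl sumr_ge0// => i _.
by rewrite mulr1 death_prob_ge0//; exact: service_rate_ge0.
Qed.

Lemma transition_eigen (f : nat -> R) beta K k : 0 <= beta -> (k < K)%N ->
  beta * f 0%N = 0 ->
  (forall i, (i < k)%N -> rate i.+1 * (f i - f i.+1) = - beta * f i.+1) ->
  \sum_(j < K) T k j * f j = alpha A beta * f k.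
Proof.
move=> b0 kK f0 hf.
have mD : measurable (`[0%R, +oo[%classic : set (measurableTypeR R)) by exact: measurable_itv.
have := @Rintegral_lincomb R _ _ (lebesgue_stieltjes_measure A) _ K
  (fun j : 'I_K => death_prob rate k j) (fun j : 'I_K => f j) mD
  (fun j => death_prob_integrable k j).
rewrite -[RHS]/(\sum_(j < K) T k j * f j) => <-.
have ie : (lebesgue_stieltjes_measure A).-integrable `[0%R, +oo[
    (EFin \o (fun x : R => expR (- beta * x))).
  apply: integrable_continuous_ge0.
    by apply: continuous_ge0W; exact: exp_linear_continuous.
  move=> x x0; rewrite expR_ge0/= -expR0 ler_expR mulNr oppr_le0.
  exact: mulr_ge0.
rewrite /alpha -[fine _]/(Rintegral _ _ _) -RintegralZr//.
apply: eq_Rintegral => x; rewrite inE/= in_itv/= andbT => x0.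
exact: death_prob_eigen.
Qed.

End TransitionMatrix.

(** * The exact formula for the loss probability *)

Section LossFormula.
Context {R : realType}.
Variables (A : cumulativeBounded (0 : R) (1 : R)) (mu : R) (m n : nat).
Hypotheses (mean_neq0 : intA A (fun x => x) != 0%E)
  (mu0 : 0 < mu) (hm : (0 < m)%N).
Variable pi : 'rV[R]_((m + n).+1).
Hypothesis (pi_stationary : stationary (transition_mx A mu m n) pi).

Let N := (m + n)%N.
Let y := mu * m%:R.
Let rate := service_rate mu m.
Let r := arrival_law A y.
Let w := takacs_incr r.
Let c := conv r w.
Let T k j : R := fine (intA A (death_prob rate k j)).
Let P (i : nat) : R := pi 0 (inord i).
Let p := pi 0 ord_max.

Let y0 : 0 < y. Proof. by rewrite mulr_gt0// ltr0n. Qed.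
Let r_gt0 i : 0 < r i. Proof. exact: arrival_law_gt0. Qed.
Let r_neq0 : r 0%N != 0. Proof. exact: lt0r_neq0. Qed.

Let T_top k j : (m <= j)%N -> T k j = if (k < j)%N then 0 else r (k - j)%N.
Proof. exact: transition_poisson. Qed.

Let P_ge0 i : 0 <= P i.
Proof. by case: pi_stationary => h _ _; exact: h. Qed.

Let PN : P N = p.
Proof. by rewrite /P /p; congr (pi 0 _); apply: val_inj; rewrite /= inordK. Qed.

Let P_sum : \sum_(i < N.+1) P i = 1.
Proof.
case: pi_stationary => _ h _; rewrite -h; apply: eq_bigr => i _.
by rewrite /P inord_val.
Qed.

Let balance j : (j <= N)%N -> P j = \sum_(i < N.+1) P i * T (minn i.+1 N) j.
Proof.
move=> jN; case: pi_stationary => _ _ h.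
rewrite {1}/P -{1}h !mxE; apply: eq_bigr => i _.
by rewrite mxE /P inord_val inordK.
Qed.

Let split_sum (F : nat -> R) :
  \sum_(i < N.+1) F i = \sum_(i < m) F i + \sum_(l < n.+1) F (m + l)%N.
Proof. by rewrite /N -addnS big_split_ord. Qed.

(* The mass of state N - l - 1, corrected at l = 0 because an arrival that finds
   the full state N leaves it in N: this makes the balance equations a plain
   convolution. *)
Let Y l : R := P (N - l.+1)%N + (l == 0)%:R * p.

(* The states from which N - k can be reached are N - l - 1 with l <= k, and N. *)
Let profile_conv k : (k <= n)%N -> P (N - k)%N = conv r Y k.
Proof.
move=> kn; have kN : (k < N)%N by rewrite /N; lia.
rewrite balance ?leq_subr// big_ord_recr /= (minn_idPr (leqnSn N)).
have mNk : (m <= N - k)%N by rewrite /N; lia.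
rewrite T_top// ltnNge leq_subr/= subKn ?(ltnW kN)// PN.
have -> : \sum_(i < N) P i * T (minn i.+1 N) (N - k)%N =
    \sum_(l < N) (if (l < k.+1)%N then P (N - l.+1)%N * r (k - l)%N else 0).
  rewrite (reindex_inj rev_ord_inj) /=; apply: eq_bigr => l _.
  have lN := ltn_ord l.
  rewrite T_top// (_ : minn (N - l.+1).+1 N = (N - l)%N); last by lia.
  have -> : (N - l < N - k)%N = ~~ (l < k.+1)%N by lia.
  case lk: (l < k.+1)%N => /=; last by rewrite mulr0.
  congr (_ * r _); lia.
rewrite -big_mkcond /= -(big_ord_widen N (fun l => P (N - l.+1)%N * r (k - l)%N))//.
rewrite convC /conv /Y [in RHS]big_ord_recl [in LHS]big_ord_recl /=.
rewrite subn0 mul1r mulrDl -addrA [in RHS]addrAC addrA; congr (_ + _ + _).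
by apply: eq_bigr => i _; rewrite mul0r addr0.
Qed.

Let cS k : c k.+1 = w k - (k == 0)%:R.
Proof. exact: conv_takacs_incrS. Qed.

(* The convolution by r is triangular with r_0 on the diagonal, so the balance
   equations determine the profile from the mass p of the full state. *)
Let profile_increment k : (k <= n)%N -> Y k = p * w k.
Proof.
elim/ltn_ind: k => k IH kn.
have prev i : (i <= k)%N -> P (N - i)%N = p * c i.
  case: i => [|i] ik; first by rewrite subn0 PN /c conv_takacs_incr0// mulr1.
  rewrite cS; transitivity (p * w i - (i == 0)%:R * p); last by ring.
  by rewrite -IH// ?(leq_trans (ltnW ik) kn)// /Y addrK.
have := profile_conv kn; rewrite prev// /c -conv_Zr.
case: k IH kn prev => [|k] IH kn _.
  by rewrite !conv0 => /(mulfI r_neq0).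
rewrite !convS (eq_bigr (fun i : 'I_k.+1 => r i.+1 * Y (k - i)%N)).
  by move/addIr => /(mulfI r_neq0).
by move=> i _; rewrite IH//; lia.
Qed.

Let profile k : (k <= n.+1)%N -> P (N - k)%N = p * c k.
Proof.
case: k => [|k] kn; first by rewrite subn0 PN /c conv_takacs_incr0// mulr1.
rewrite cS; transitivity (p * w k - (k == 0)%:R * p); last by ring.
by rewrite -profile_increment// /Y addrK.
Qed.

Let top_sum : \sum_(l < n.+1) P (m + l)%N = p * \sum_(k < n.+1) c k.
Proof.
rewrite mulr_sumr (reindex_inj rev_ord_inj) /=; apply: eq_bigr => k _.
rewrite -profile ?(leq_trans (ltnW (ltn_ord k)))//; congr (P _).
by have := ltn_ord k; rewrite /N; lia.
Qed.

(* [f j] is the eigenfunction for the rate mu j, with ratio [theta j] above m; [b j]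
   is the truncated binomial moment and [D j] collects the mass at or above m. *)
Let z j : R := (m - j)%:R / m%:R.
Let phi j := phi A mu j.
Let theta j : R := (z j)^-1.
Let f j k : R := 'C(minn k m, j)%:R * theta j ^+ (k - m).
Let b j : R := \sum_(i < m) 'C(i, j)%:R * P i.
Let D j : R := (theta j - (phi j)^-1) * conv (fun l => theta j ^+ l) c n
    - theta j ^+ n * (theta j - 1).

Let m_neq0 : m%:R != 0 :> R. Proof. by rewrite pnatr_eq0 -lt0n. Qed.

Let z_neq0 j : (j < m)%N -> z j != 0.
Proof. by move=> jm; rewrite mulf_neq0 ?invr_eq0// pnatr_eq0 -lt0n subn_gt0. Qed.

Lemma phi_pgf j : (j <= m)%N -> phi j = alpha A (y - y * z j).
Proof.
move=> jm; rewrite /phi /Defs.phi; congr alpha.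
by rewrite /y /z natrB//; field.
Qed.

Lemma z_ge0_le1 j : 0 <= z j <= 1.
Proof.
by rewrite divr_ge0//= ler_pdivrMr ?ltr0n// mul1r ler_nat leq_subr.
Qed.

Lemma phi_gt0 j : (j <= m)%N -> 0 < phi j.
Proof.
move=> jm; rewrite phi_pgf//; apply: pgf_gt0 => //.
exact: z_ge0_le1.
Qed.

Let eigen j i : (0 < j < m)%N ->
  rate i.+1 * (f j i - f j i.+1) = - (mu * j%:R) * f j i.+1.
Proof.
case: j => // j /= jm.
have th : theta j.+1 * (m%:R - j.+1%:R) = m%:R.
  rewrite /theta /z natrB ?(ltnW jm)// invf_div divfK//.
  by rewrite subr_eq0 eqr_nat gtn_eqF.
rewrite /f /rate /service_rate; have [im|mi] := ltnP i m.
  have e1 : minn i.+1 m = i.+1 by lia.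
  have e2 : (i - m = 0)%N by lia.
  have e3 : (i.+1 - m = 0)%N by lia.
  rewrite e1 e2 e3 expr0 !mulr1 binS natrD.
  have := congr1 (fun k : nat => k%:R : R) (mul_bin_diag i.+1 j); rewrite /= binS !natrM natrD.
  move=> e; rewrite opprD addrA addrC.
  transitivity (- (mu * (i.+1%:R * 'C(i, j)%:R))); first by ring.
  by rewrite e; ring.
have e1 : minn i.+1 m = m by lia.
rewrite e1 subSn// exprS.
transitivity (mu * 'C(m, j.+1)%:R * theta j.+1 ^+ (i - m) * (m%:R - theta j.+1 * m%:R)).
  by ring.
rewrite -{1}th; ring.
Qed.

Let eigen_balance j : (0 < j < m)%N ->
  \sum_(i < N.+1) P i * f j i = phi j * \sum_(i < N.+1) P i * f j (minn i.+1 N).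
Proof.
move=> jm.
rewrite (eq_bigr (fun j' : 'I_N.+1 => \sum_(i < N.+1) P i * T (minn i.+1 N) j' * f j j')); last first.
  by move=> i _; rewrite [in LHS]balance ?leq_ord// mulr_suml.
rewrite exchange_big /= mulr_sumr; apply: eq_bigr => i _.
have tE : \sum_(j' < N.+1) T (minn i.+1 N) j' * f j j' = phi j * f j (minn i.+1 N).
  apply: (transition_eigen A mu0).
  - by rewrite mulr_ge0// ltW.
  - by rewrite ltnS geq_minr.
  - by rewrite /f min0n bin0n gtn_eqF ?mul0r ?mulr0//; case/andP: jm.
  - by move=> k _; exact: eigen.
by rewrite [RHS]mulrCA -tE mulr_sumr; apply: eq_bigr => j' _; exact/esym/mulrA.
Qed.

(* An arrival moves i to i + 1: below m this adds b_(j-1) by the Pascal rule, above m it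
   multiplies by [theta j], except at the full state where the arrival is lost. *)
Let binomial_moment_recursion j : (0 < j < m)%N ->
  (1 - phi j) * b j = phi j * (b j.-1 + p * ('C(m, j)%:R * D j)).
Proof.
move=> jm; have := eigen_balance jm.
rewrite (split_sum (fun i => P i * f j i)) (split_sum (fun i => P i * f j (minn i.+1 N))).
have j0 : (0 < j)%N by case/andP: jm.
have [ph0 th0] : phi j != 0 /\ theta j != 0.
  case/andP: jm => _ jm; split; first by rewrite lt0r_neq0// phi_gt0// ltnW.
  by rewrite invr_eq0 z_neq0.
have -> : \sum_(i < m) P i * f j i = b j.
  apply: eq_bigr => i _; have im := ltn_ord i.
  have e1 : minn i m = i by apply/minn_idPl; exact: ltnW.
  have e2 : (i - m = 0)%N by apply/eqP; rewrite subn_eq0 ltnW.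
  by rewrite /f e1 e2 expr0 mulr1 mulrC.
have -> : \sum_(i < m) P i * f j (minn i.+1 N) = b j + b j.-1.
  rewrite -big_split /=; apply: eq_bigr => i _; have im := ltn_ord i.
  have e1 : minn i.+1 N = i.+1 by apply/minn_idPl; rewrite (leq_trans im) ?leq_addr.
  have e2 : minn i.+1 m = i.+1 by apply/minn_idPl.
  have e3 : (i.+1 - m = 0)%N by apply/eqP; rewrite subn_eq0.
  rewrite /f e1 e2 e3 expr0 mulr1.
  have -> : 'C(i.+1, j) = ('C(i, j) + 'C(i, j.-1))%N by rewrite -{1 2}(prednK j0) binS.
  by rewrite natrD mulrC mulrDl.
pose t : R := conv (fun l => theta j ^+ l) c n.
have tE : \sum_(l < n.+1) P (m + l)%N * theta j ^+ l = p * t.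
  rewrite /t /conv mulr_sumr; apply: eq_bigr => l _.
  have ln := ltn_ord l.
  have -> : (m + l = N - (n - l))%N by rewrite /N; lia.
  by rewrite profile; [rewrite mulrA mulrAC|rewrite leqW// leq_subr].
have -> : \sum_(l < n.+1) P (m + l)%N * f j (m + l)%N = 'C(m, j)%:R * (p * t).
  rewrite -tE mulr_sumr; apply: eq_bigr => l _.
  have e1 : minn (m + l) m = m by apply/minn_idPr; exact: leq_addr.
  by rewrite /f e1 addKn mulrCA.
have -> : \sum_(l < n.+1) P (m + l)%N * f j (minn (m + l).+1 N) =
    'C(m, j)%:R * (theta j * (p * t) - p * (theta j ^+ n * (theta j - 1))).
  rewrite -tE !big_ord_recr /= -/N PN /f.
  have e1 : minn N.+1 N = N by apply/minn_idPr; exact: leqnSn.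
  have e2 : minn N m = m by apply/minn_idPr; exact: leq_addr.
  have e3 : (N - m = n)%N by exact: addKn.
  rewrite e1 e2 e3.
  have -> : \sum_(l < n) P (m + l)%N * ('C(minn (minn (m + l).+1 N) m, j)%:R *
       theta j ^+ (minn (m + l).+1 N - m)) =
      'C(m, j)%:R * (theta j * (\sum_(l < n) P (m + l)%N * theta j ^+ l)).
    rewrite !mulr_sumr; apply: eq_bigr => l _; have ln := ltn_ord l.
    have e4 : (minn (m + l).+1 N = m + l.+1)%N.
      by rewrite -addnS; apply/minn_idPl; rewrite leq_add2l.
    have e5 : (minn (m + l.+1) m = m)%N by apply/minn_idPr; exact: leq_addr.
    rewrite e4 e5 addKn exprS.
    by rewrite mulrCA; congr (_ * _); rewrite mulrCA.
  by ring.
move=> E.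
transitivity (b j + 'C(m, j)%:R * (p * t) - 'C(m, j)%:R * (p * t) - phi j * b j); first by ring.
by rewrite E /D -/t; field.
Qed.

(* The two ends of the recursion: the total mass and the mass of state m - 1. *)
Let b0 : b 0 = 1 - p * \sum_(k < n.+1) c k.
Proof.
rewrite -P_sum (split_sum P) top_sum addrK; apply: eq_bigr => i _.
by rewrite bin0 mul1r.
Qed.

Let b_last : b m.-1 = p * c n.+1.
Proof.
have mm : (m.-1 < m)%N by rewrite prednK.
rewrite -profile// /b (bigD1 (Ordinal mm))//= binn mul1r big1 ?addr0.
  by congr (P _); rewrite /N; lia.
move=> i ni; rewrite bin_small ?mul0r// ltn_neqAle.
by rewrite -[(i : nat) == m.-1]/(i == Ordinal mm) ni -ltnS prednK//=.
Qed.

(** The factors [Cj] turn the recursion for the truncated binomial moments into a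
    telescoping sum. *)
Lemma loss_telescope :
  p * (\sum_(k < n.+1) c k + Cj A mu m.-1 * c n.+1
       - \sum_(1 <= j < m) Cj A mu j.-1 * 'C(m, j)%:R * D j) = 1.
Proof.
have H J : (J < m)%N -> b J * Cj A mu J =
    b 0 + p * \sum_(1 <= j < J.+1) Cj A mu j.-1 * 'C(m, j)%:R * D j.
  elim: J => [|J IH] Jm; first by rewrite /Cj !big_geq// mulr1 mulr0 addr0.
  rewrite big_nat_recr//= mulrDr addrA -IH ?(ltnW Jm)//.
  have ph0 : phi J.+1 != 0 by rewrite lt0r_neq0// phi_gt0// ltnW.
  have := binomial_moment_recursion (j := J.+1) Jm; rewrite /= => e.
  rewrite {1}/Cj big_nat_recr//= -/(Cj A mu J) -/(phi J.+1).
  transitivity (((1 - phi J.+1) * b J.+1) * (Cj A mu J / phi J.+1)); first by ring.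
  by rewrite e; field.
have mm : (m.-1 < m)%N by rewrite prednK.
have := H _ mm; rewrite b_last b0 prednK// => e.
apply/eqP; rewrite -subr_eq0; apply/eqP.
transitivity (p * c n.+1 * Cj A mu m.-1 - (1 - p * (\sum_(k < n.+1) c k) +
    p * \sum_(1 <= j < m) Cj A mu j.-1 * 'C(m, j)%:R * D j)); first by ring.
by rewrite e subrr.
Qed.

Lemma loss_ge0 : 0 <= p. Proof. by rewrite -PN. Qed.

Lemma loss_top_le1 : p * \sum_(k < n.+1) c k <= 1.
Proof. by rewrite -top_sum -P_sum (split_sum P) lerDr sumr_ge0. Qed.

End LossFormula.

(** The value of 1/p with n + 1 waiting places; see [loss_formula]. *)
Definition loss_inv (R : realType) (A : cumulativeBounded (0 : R) (1 : R))
    (mu : R) (m n : nat) : R :=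
  let r := arrival_law A (mu * m%:R) in
  takacs r n + Cj A mu m.-1 * takacs_incr r n.+1
  - \sum_(1 <= j < m) Cj A mu j.-1 * 'C(m, j)%:R *
     ((m - j)%:R / m%:R / phi A mu j *
        conv (ddiff r ((m - j)%:R / m%:R) (phi A mu j)) (takacs_incr r) n.+1
      - takacs_incr r n.+1).

Lemma loss_formula (R : realType) (A : cumulativeBounded (0 : R) (1 : R))
    (mu : R) (m n : nat) (p : R) :
  intA A (fun x => x) != 0%E -> 0 < mu -> (0 < m)%N ->
  is_loss_probability A mu m n.+1 p ->
  [/\ 0 < p, p * loss_inv A mu m n = 1 & p * takacs (arrival_law A (mu * m%:R)) n <= 1].
Proof.
move=> mean0 mu0 hm [pi hpi ->].
have y0 : 0 < mu * m%:R by rewrite mulr_gt0// ltr0n.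
have r0 : arrival_law A (mu * m%:R) 0 != 0 by rewrite lt0r_neq0// arrival_law_gt0.
have e := loss_telescope mean0 mu0 hm hpi.
have l := loss_top_le1 mean0 mu0 hm hpi.
rewrite takacs_sum_profile// in e l.
have eq1 : pi 0 ord_max * loss_inv A mu m n = 1.
  rewrite -[RHS]e /loss_inv; congr (_ * _); congr (_ - _).
    by rewrite conv_takacs_incrS// subr0.
  rewrite big_nat [RHS]big_nat; apply: eq_bigr => j /andP[j1 jm]; congr (_ * _).
  rewrite geometric_profile//=.
  - by rewrite sub0r addrC.
  - by rewrite mulf_neq0 ?invr_eq0// pnatr_eq0 -lt0n// subn_gt0.
  - by rewrite lt0r_neq0// (phi_gt0 (m := m))// ltnW.
split => //; rewrite lt_neqAle (loss_ge0 hpi) andbT.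
by apply/eqP => p0; move: eq1; rewrite -p0 mul0r => /eqP; rewrite eq_sym oner_eq0.
Qed.

(** * Limits of the formula *)

Section LossAsymptotics.
Context {R : realType}.
Variables (A : cumulativeBounded (0 : R) (1 : R)) (mu : R) (m : nat).
Hypotheses (hA : nonneg_cdf A) (mean_neq0 : intA A (fun x => x) != 0%E)
  (mu0 : 0 < mu) (hm : (0 < m)%N).

Let y := mu * m%:R.
Let r := arrival_law A y.
Let v := takacs r.
Let w := takacs_incr r.
Let z j : R := (m - j)%:R / m%:R.
Let phi j := phi A mu j.
Let H j := ddiff r (z j) (phi j).

Let y0 : 0 < y. Proof. by rewrite mulr_gt0// ltr0n. Qed.
Let r_gt0 i : 0 < r i. Proof. exact: arrival_law_gt0. Qed.
Let r_ge0 i : 0 <= r i. Proof. exact: ltW. Qed.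
Let m_neq0 : m%:R != 0 :> R. Proof. by rewrite pnatr_eq0 -lt0n. Qed.
Let z_gt0 j : (j < m)%N -> 0 < z j.
Proof. by move=> jm; rewrite divr_gt0 ?ltr0n// subn_gt0. Qed.
Let z_lt1 j : (0 < j)%N -> z j < 1.
Proof.
move=> j0; rewrite ltr_pdivrMr ?ltr0n// mul1r ltr_nat.
by rewrite ltn_subrL j0.
Qed.
Let z_pgf j : (j <= m)%N -> series (fun i => r i * z j ^+ i) @ \oo --> phi j.
Proof.
move=> jm; rewrite (_ : phi j = alpha A (y - y * z j)); last exact: (phi_pgf A mu hm jm).
by apply: arrival_law_pgf => //; exact: z_ge0_le1.
Qed.
Let H_ge0 j k : (j < m)%N -> 0 <= H j k.
Proof. by move=> jm; apply: ddiff_ge0 => //; [exact: z_gt0|exact/z_pgf/ltnW]. Qed.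

(** With weights s^k the sequence w tends to W = (1 - s)/(s (1 - R'(s))), and a
    convolution with H_j tends to W times the sum of H_j with these weights. *)
Lemma loss_inv_cvg (s D : R) (h : nat -> R) : 0 < s ->
  series (fun i => r i * s ^+ i) @ \oo --> s ->
  series (fun i => i%:R * (r i * s ^+ i)) @ \oo --> D -> D / s < 1 ->
  (forall j, (0 < j < m)%N -> series (fun k => H j k * s ^+ k) @ \oo --> h j) ->
  (fun n => s ^+ n.+1 * loss_inv A mu m n) @ \oo -->
  (1 - D / s)^-1 * (1 + (1 - s) / s * (Cj A mu m.-1 -
     \sum_(1 <= j < m) Cj A mu j.-1 * 'C(m, j)%:R * (z j / phi j * h j - 1))).
Proof.
move=> s0 rs rD D1 hh; have sn0 : s != 0 by rewrite lt0r_neq0.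
set L := (1 - D / s)^-1; set W := L * ((1 - s) / s).
have vL : (fun n => s ^+ n.+1 * v n) @ \oo --> L.
  exact: (takacs_root_cvg r_ge0 (r_gt0 0%N) s0 rs rD D1).
have wW : (fun n => w n.+1 * s ^+ n.+1) @ \oo --> W.
  have -> : (fun n => w n.+1 * s ^+ n.+1) =
      (fun n => s^-1 * (s ^+ n.+2 * v n.+1) - s ^+ n.+1 * v n).
    by apply/funext => n; rewrite /w /takacs_incr /= -/v !exprS; field.
  have -> : W = s^-1 * L - L by rewrite /W; field.
  apply: cvgB => //; apply: cvgM; first exact: cvg_cst.
  by rewrite (cvg_shiftS (fun n => s ^+ n.+1 * v n)).
have wW0 : (fun n => w n * s ^+ n) @ \oo --> W.
  by rewrite -cvg_shiftS.
have hW j : (0 < j < m)%N ->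
    (fun n => conv (H j) w n.+1 * s ^+ n.+1) @ \oo --> h j * W.
  move=> jm; rewrite (cvg_shiftS (fun n => conv (H j) w n * s ^+ n)).
  under eq_fun do rewrite -conv_geometric.
  apply: conv_cvg => //; last exact: hh.
  by move=> k; rewrite mulr_ge0 ?exprn_ge0 ?(ltW s0)// H_ge0//; case/andP: jm.
have -> : (fun n => s ^+ n.+1 * loss_inv A mu m n) =
  (fun n => s ^+ n.+1 * v n + Cj A mu m.-1 * (w n.+1 * s ^+ n.+1) -
    \sum_(j <- index_iota 1 m) Cj A mu j.-1 * 'C(m, j)%:R *
      (z j / phi j * (conv (H j) w n.+1 * s ^+ n.+1) - w n.+1 * s ^+ n.+1)).
  apply/funext => n; rewrite /loss_inv -/y -/r -/v -/w mulrBr mulrDr mulr_sumr.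
  congr (_ + _ - _); first by ring.
  by apply: eq_bigr => j _; rewrite -/(z j) -/(phi j) -/(H j); ring.
have -> : L * (1 + (1 - s) / s * (Cj A mu m.-1 -
     \sum_(1 <= j < m) Cj A mu j.-1 * 'C(m, j)%:R * (z j / phi j * h j - 1))) =
  L + Cj A mu m.-1 * W - \sum_(j <- index_iota 1 m) Cj A mu j.-1 * 'C(m, j)%:R *
      (z j / phi j * (h j * W) - W).
  rewrite mulrDr mulr1 mulrA -/W mulrBr addrA mulr_sumr [W * _]mulrC.
  by congr (_ - _); apply: eq_bigr => j _; ring.
apply: cvgB.
  by apply: cvgD => //; apply: cvgM => //; exact: cvg_cst.
apply: cvg_bigsum => j; rewrite mem_index_iota => jm.
apply: cvgM; first exact: cvg_cst.
apply: cvgB => //; apply: cvgM; first exact: cvg_cst.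
exact: hW.
Qed.

Lemma ddiff_phi_series j s : (0 < j < m)%N -> 0 < s <= 1 -> s != z j ->
  series (fun k => H j k * s ^+ k) @ \oo -->
  (alpha A (y - y * s) - phi j) / (s - z j).
Proof.
case/andP=> j0 jm /andP[s0 s1] sz.
apply: ddiff_series => //; [exact: z_gt0|exact/z_pgf/ltnW|].
by apply: arrival_law_pgf => //; rewrite s1 ltW.
Qed.

Lemma loss_inv_sub_takacs_bounded : series (fun i => i%:R * r i) @ \oo --> (1 : R) ->
  exists2 K : R, 0 < K & forall n, `|loss_inv A mu m n - v n| <= K.
Proof.
move=> r1.
have rsum : series r @ \oo --> (1 : R) by exact: arrival_law_sum.
have wB n : 0 <= w n <= (r 0%N)^-1 by exact: (takacs_incr_bounds r_ge0 _ rsum r1).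
pose h j := (alpha A (y - y * 1) - phi j) / (1 - z j).
have HB j n : (0 < j < m)%N -> 0 <= conv (H j) w n <= h j * (r 0%N)^-1.
  move=> jm; have jm' : (j < m)%N by case/andP: jm.
  have hs : series (H j) @ \oo --> h j.
    have := @ddiff_phi_series j 1 jm; rewrite ltr01 lexx gt_eqF ?z_lt1//; last by case/andP: jm.
    by move=> /(_ isT isT); under eq_fun do rewrite expr1n mulr1.
  apply/andP; split; first by apply: conv_ge0 => k; [exact: H_ge0|case/andP: (wB k)].
  apply: (@le_trans _ _ (\sum_(k < n.+1) H j k * (r 0%N)^-1)).
    by apply: ler_sum => k _; rewrite ler_wpM2l ?H_ge0//; case/andP: (wB (n - k)%N).
  rewrite -mulr_suml ler_wpM2r ?invr_ge0//.
  by apply: partial_sum_le => // k; exact: H_ge0.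
pose K := `|Cj A mu m.-1| * (r 0%N)^-1 + \sum_(1 <= j < m) `|Cj A mu j.-1 * 'C(m, j)%:R| *
   (`|z j / phi j| * (h j * (r 0%N)^-1) + (r 0%N)^-1).
exists (K + 1).
  rewrite ltr_wpDl// addr_ge0 ?mulr_ge0 ?invr_ge0//.
  rewrite big_nat; apply: sumr_ge0 => j jm; rewrite mulr_ge0// addr_ge0 ?invr_ge0//.
  rewrite mulr_ge0//; case/andP: (HB j 0%N jm) => h1 h2; exact: le_trans h1 h2.
move=> n; apply: (@le_trans _ _ K); last by rewrite lerDl.
rewrite /loss_inv -/y -/r -/v -/w.
set S := \sum_(1 <= j < m) _.
have -> : v n + Cj A mu m.-1 * w n.+1 - S - v n = Cj A mu m.-1 * w n.+1 - S by ring.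
rewrite (le_trans (ler_normB _ _))// lerD//.
  rewrite normrM ler_wpM2l//; case/andP: (wB n.+1) => h1 h2; by rewrite ger0_norm.
rewrite (le_trans (ler_norm_sum _ _ _))// big_nat [leRHS]big_nat; apply: ler_sum => j jm.
rewrite normrM ler_wpM2l// (le_trans (ler_normB _ _))// lerD//; last first.
  by case/andP: (wB n.+1) => h1 h2; rewrite ger0_norm.
rewrite normrM ler_wpM2l//; case/andP: (HB j n.+1 jm) => h1 h2.
by rewrite ger0_norm.
Qed.

End LossAsymptotics.

Lemma arrival_law_mean (R : realType) (A : cumulativeBounded (0 : R) (1 : R))
    (y M : R) : 0 < y -> intA A (fun x => x) = M%:E ->
  series (fun i => i%:R * arrival_law A y i) @ \oo --> y * M.
Proof.
move=> y0 hM.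
apply: (@arrival_law_series _ A y y0 _ (fun x => y * x)) => [i|x _|].
- exact: ler0n.
- have := @poisson_factorial_moment R y 1 x; rewrite expr1 (_ : 1`! = 1)%N// divr1.
  by under eq_fun do rewrite bin1.
- rewrite /intA; under eq_integral do rewrite EFinM.
  rewrite ge0_integralZl_EFin ?ltW//.
  + by rewrite EFinM -hM.
  + by move=> x /=; rewrite in_itv/= andbT lee_fin.
Qed.

(** For u >= 0 one has u^2 <= 1 + u^3. *)
Lemma moment2_lty (R : realType) (A : cumulativeBounded (0 : R) (1 : R)) (mu : R) (m : nat) :
  0 < mu -> (rho_ A mu m 3 < +oo)%E -> (rho_ A mu m 2 < +oo)%E.
Proof.
move=> mu0 h3.
have ck k : continuous_ge0 (fun x : R => (mu * m%:R * x) ^+ k).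
  apply: continuous_ge0W => x.
  apply: (@continuous_comp _ _ _ (fun u : R => mu * m%:R * u) (fun u : R => u ^+ k)).
    by apply: cvgM; [exact: cvg_cst|exact: cvg_id].
  exact: exprn_continuous.
have y0 (x : R) : 0 <= x -> 0 <= mu * m%:R * x by move=> x0; rewrite !mulr_ge0// ltW.
have dD (x : R) : `[0%R, +oo[%classic x -> 0 <= x by rewrite /= in_itv/= andbT.
have mD : measurable (`[0%R, +oo[%classic : set (measurableTypeR R)) by exact: measurable_itv.
apply: (@le_lt_trans _ _
  (\int[lebesgue_stieltjes_measure A]_(x in `[0%R, +oo[) (1 + ((mu * m%:R * x) ^+ 3)%:E))%E).
  apply: ge0_le_integral => //.
  - by move=> x /dD x0; rewrite lee_fin exprn_ge0// y0.
  - exact: measurable_continuous_ge0.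
  - apply: emeasurable_funD => //; exact: measurable_continuous_ge0.
  - move=> x /dD /y0; set u := _ * x => u0.
    rewrite -EFinD lee_fin; have [u1|/ltW u1] := leP u 1.
      by rewrite (le_trans (exprn_ile1 _ u0 u1))// lerDl exprn_ge0.
    by rewrite (le_trans (ler_weXn2l u1 (leqnSn 2)))// lerDr.
rewrite ge0_integralD//; last 2 first.
- by move=> x /dD x0; rewrite lee_fin exprn_ge0// y0.
- exact: measurable_continuous_ge0.
rewrite lte_add_pinfty// integral_cst// mul1e.
apply: (@le_lt_trans _ _ 1%E); last exact: ltry.
exact: (@probability_le1 _ _ _ (lebesgue_stieltjes_measure A)).
Qed.

Section LossLimits.
Context {R : realType}.
Variables (A : cumulativeBounded (0 : R) (1 : R)) (mu lambda : R) (m : nat) (p : nat -> R).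
Hypotheses (hA : nonneg_cdf A) (mu0 : 0 < mu) (lambda0 : 0 < lambda) (hm : (0 < m)%N)
  (hmean : intA A (fun x => x) = (lambda^-1)%:E)
  (hp : forall n, is_loss_probability A mu m n (p n)).

Let y := mu * m%:R.
Let r := arrival_law A y.
Let v := takacs r.
Let l n := loss_inv A mu m n.
Let a := y / lambda.
Let m_neq0 : m%:R != 0 :> R. Proof. by rewrite pnatr_eq0 -lt0n. Qed.
Let y0 : 0 < y. Proof. by rewrite mulr_gt0// ltr0n. Qed.
Let mean_neq0 : intA A (fun x => x) != 0%E.
Proof. by rewrite hmean eqe invr_eq0 lt0r_neq0. Qed.
Let r_gt0 i : 0 < r i. Proof. exact: arrival_law_gt0. Qed.
Let r_ge0 i : 0 <= r i. Proof. exact: ltW. Qed.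
Let r_sum : series r @ \oo --> (1 : R). Proof. exact: arrival_law_sum. Qed.
Let r_mean : series (fun i => i%:R * r i) @ \oo --> a. Proof. exact: arrival_law_mean. Qed.

Lemma load_inv : load lambda mu m = a^-1.
Proof. by rewrite /load /a /y invf_div [mu * _]mulrC. Qed.

Let p_gt0 n : 0 < p n.+1. Proof. by have [] := loss_formula mean_neq0 mu0 hm (hp n.+1). Qed.
Let p_l n : p n.+1 * l n = 1. Proof. by have [] := loss_formula mean_neq0 mu0 hm (hp n.+1). Qed.
Let pE n : p n.+1 = (l n)^-1.
Proof.
have ln : l n != 0 by apply/eqP => e; move: (p_l n); rewrite e mulr0 => /eqP; rewrite eq_sym oner_eq0.
by apply: (mulIf ln); rewrite p_l mulVf.
Qed.
Let v_le_l n : v n <= l n.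
Proof.
have [_ _ h] := loss_formula mean_neq0 mu0 hm (hp n.+1).
by rewrite -(ler_pM2l (p_gt0 n)) p_l.
Qed.

Lemma loss_overloaded : 1 < load lambda mu m ->
  p n @[n --> \oo] --> (load lambda mu m - 1) / load lambda mu m.
Proof.
rewrite load_inv => a1.
have a0 : 0 < a by rewrite divr_gt0.
have al1 : a < 1 by rewrite -(invrK a) invf_lt1// invr_gt0.
rewrite (_ : (a^-1 - 1) / a^-1 = 1 - a); last by field; rewrite lt0r_neq0.
rewrite -cvg_shiftS (funext pE) -[1 - a]invrK.
apply: cvgV; first by rewrite invr_eq0 subr_eq0 gt_eqF.
pose h j := (alpha A (y - y * 1) - phi A mu j) / (1 - (m - j)%:R / m%:R).
have := @loss_inv_cvg _ A mu m mean_neq0 mu0 hm 1 a h ltr01.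
rewrite !divr1 subrr mul0r addr0 mulr1.
have -> : (fun n => 1 ^+ n.+1 * loss_inv A mu m n) = l.
  by apply/funext => n; rewrite expr1n mul1r.
apply => //.
- by under eq_fun do rewrite expr1n mulr1.
- by under eq_fun do rewrite expr1n mulr1.
- move=> j jm; apply: ddiff_phi_series => //; first by rewrite ltr01 lexx.
  rewrite eq_sym lt_eqF// ltr_pdivrMr ?ltr0n// mul1r ltr_nat ltn_subrL hm andbT.
  by case/andP: jm.
Qed.

Section Subcritical.
Variable s : R.
Hypotheses (a1 : 1 < a) (hs : least_abs_root A mu m s).

Let s01 : 0 < s < 1 /\ alpha A (y - y * s) = s.
Proof. by case: hs => h1 h2; apply: (least_root_pgf hA mean_neq0 y0 r_mean a1 h1). Qed.
Let s0 : 0 < s. Proof. by case: s01 => /andP[]. Qed.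
Let s1 : s < 1. Proof. by case: s01 => /andP[]. Qed.
Let sG : alpha A (y - y * s) = s. Proof. by case: s01. Qed.
Let q := - (y * derive1 (alpha A) (y - y * s)).
Let rs : series (fun i => r i * s ^+ i) @ \oo --> s.
Proof. by rewrite -{2}sG; apply: arrival_law_pgf => //; rewrite !ltW. Qed.
Let rD : series (fun i => i%:R * (r i * s ^+ i)) @ \oo --> q * s.
Proof.
have -> : q * s = - (y * s * derive1 (alpha A) (y - y * s)) by rewrite /q; ring.
by apply: pgf_derivative => //; rewrite s0 s1.
Qed.
Let q1 : q < 1.
Proof.
by have := pgf_root_slope hA mean_neq0 y0 (proj1 s01) sG rD; rewrite mulfK// lt0r_neq0.
Qed.

Let z j : R := (m - j)%:R / m%:R.
(* The sum of the divided difference at [z j] with weights s^k; when [z j] is the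
   root itself this is the derivative of R there. *)
Let h j : R := if s == z j then q else (s - phi A mu j) / (s - z j).
Let B : R := (1 - s) / s * (Cj A mu m.-1 -
     \sum_(1 <= j < m) Cj A mu j.-1 * 'C(m, j)%:R * (z j / phi A mu j * h j - 1)).

Let l_cvg : (fun n => s ^+ n.+1 * l n) @ \oo --> (1 - q)^-1 * (1 + B).
Proof.
have sN : s != 0 by rewrite lt0r_neq0.
have := @loss_inv_cvg _ A mu m mean_neq0 mu0 hm s (q * s) h s0 rs rD.
rewrite mulfK// => /(_ q1); apply => j jm; rewrite /h; case: eqVneq => [sz|sz].
  rewrite -/(z j) -sz (_ : phi A mu j = s); last first.
    rewrite (phi_pgf A mu hm); first by rewrite -/(z j) -sz.
    by case/andP: jm => _ /ltnW.
  by rewrite -[X in _ --> X](mulfK sN); apply: ddiff_diag_series.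
have s01' : 0 < s <= 1 by rewrite s0 ltW.
by have := ddiff_phi_series (A := A) mean_neq0 mu0 hm jm s01' sz; rewrite -/y sG.
Qed.

(* As p v_n <= 1, the limit of s^(n+1) / p is at least that of s^(n+1) v_n, hence
   positive; this makes the inverse that defines [K_] a genuine one. *)
Let B_ge0 : (1 - q)^-1 <= (1 - q)^-1 * (1 + B).
Proof.
have sN : s != 0 by rewrite lt0r_neq0.
have vL : (fun n => s ^+ n.+1 * v n) @ \oo --> (1 - q)^-1.
  have := takacs_root_cvg r_ge0 (r_gt0 0%N) s0 rs rD; rewrite mulfK// => /(_ q1); exact.
rewrite -(cvg_lim _ l_cvg)// -(cvg_lim _ vL)//; apply: ler_lim.
- by apply/cvg_ex; eexists; exact: vL.
- by apply/cvg_ex; eexists; exact: l_cvg.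
- by near=> n; rewrite ler_wpM2l// exprn_ge0// ltW.
Unshelve. all: by end_near. Qed.

Let phi_bounds j : (0 < j <= m)%N -> 0 < phi A mu j < 1.
Proof.
case/andP=> j0 jm; rewrite (phi_gt0 (m := m))//= (phi_pgf A mu hm)//.
apply: pgf_lt1 => //; case/andP: (z_ge0_le1 (R := R) hm j) => z0 _; rewrite z0/=.
by rewrite ltr_pdivrMr ?ltr0n// mul1r ltr_nat ltn_subrL j0.
Qed.

(* The term of index m in [K_] comes from the mass of the boundary state m - 1; the
   others match one by one. *)
Let K_eq : K_ A mu m s = (1 + B)^-1.
Proof.
have sN : s != 0 by rewrite lt0r_neq0.
have CS j : (0 < j <= m)%N -> Cj A mu j / (1 - phi A mu j) = Cj A mu j.-1 / phi A mu j.
  case: j => // j jm; have /andP[ph0 ph1] := phi_bounds jm.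
  have hn1 : 1 - phi A mu j.+1 != 0 by rewrite subr_eq0 gt_eqF.
  have hn2 : phi A mu j.+1 != 0 by rewrite lt0r_neq0.
  rewrite {1}/Cj big_nat_recr//= -/(Cj A mu j).
  by field; rewrite hn1 hn2.
pose G j := s^-1 * (Cj A mu j.-1 * 'C(m, j)%:R * (1 - z j / phi A mu j * h j)).
have summand j : (0 < j < m)%N ->
    'C(m, j)%:R * Cj A mu j / (1 - phi A mu j) * K_ratio A mu m s j = G j.
  move=> jm; have jm' : (0 < j <= m)%N by case/andP: jm => -> /ltnW.
  have /andP[j0 jlt] := jm.
  have /andP[ph0 _] := phi_bounds jm'; have phN : phi A mu j != 0 by rewrite lt0r_neq0.
  rewrite -[_ * Cj A mu j / _]mulrA CS//.
  have zE : m%:R * z j = m%:R - j%:R by rewrite /z natrB ?(ltnW jlt)// mulrCA divff// mulr1.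
  have dE : m%:R * (1 - s) - j%:R = m%:R * (z j - s) by rewrite mulrBr mulr1 mulrBr zE; ring.
  rewrite /G /K_ratio /h dE mulf_eq0 (negbTE m_neq0)/= subr_eq0 eq_sym.
  case: eqVneq => [sz|sz].
    have phE : phi A mu j = s.
      by rewrite (phi_pgf A mu hm (ltnW jlt)) -/(z j) -sz.
    have muE : mu * j%:R = y - y * s.
      by rewrite sz /y -!mulrA -mulrBr zE; ring.
    by rewrite muE phE -sz /q -/y; field.
  have nE : m%:R * (1 - phi A mu j) - j%:R = m%:R * (z j - phi A mu j).
    by rewrite mulrBr mulr1 mulrBr zE; ring.
  have sz1 : z j - s != 0 by rewrite subr_eq0 eq_sym.
  have sz2 : s - z j != 0 by rewrite subr_eq0.
  by rewrite nE; field; rewrite sN phN sz1 sz2 m_neq0.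
rewrite /K_ /B; congr (1 + _)^-1; rewrite -[RHS]mulrA; congr (_ * _).
rewrite big_nat_recr//= big_nat (eq_bigr G); last by move=> j jm; exact: summand.
rewrite -big_nat mulrBr addrC; congr (_ + _).
  have mm : (0 < m <= m)%N by rewrite hm leqnn.
  have /andP[ph0 _] := phi_bounds mm; have phN : phi A mu m != 0 by rewrite lt0r_neq0.
  rewrite -[_ * Cj A mu m / _]mulrA CS// binn mul1r /K_ratio.
  have -> : m%:R * (1 - s) - m%:R = - (m%:R * s) by ring.
  by rewrite oppr_eq0 mulf_eq0 (negbTE m_neq0) (negbTE sN)/=; field; rewrite sN phN m_neq0.
rewrite -mulrN -sumrN mulr_sumr; apply: eq_bigr => j _.
by rewrite /G; ring.
Qed.

Lemma loss_underloaded :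
  p n / s ^+ n @[n --> \oo] --> K_ A mu m s * (1 + y * derive1 (alpha A) (y - y * s)).
Proof.
have sN : s != 0 by rewrite lt0r_neq0.
have q0 : 0 < 1 - q by rewrite subr_gt0.
rewrite -cvg_shiftS.
have -> : (fun n => p n.+1 / s ^+ n.+1) = (fun n => (s ^+ n.+1 * l n)^-1).
  by apply/funext => n; rewrite pE invfM mulrC.
have -> : K_ A mu m s * (1 + y * derive1 (alpha A) (y - y * s)) = ((1 - q)^-1 * (1 + B))^-1.
  by rewrite K_eq invfM invrK mulrC; congr (_ * _); rewrite /q opprK.
apply: cvgV => //; rewrite lt0r_neq0// (lt_le_trans _ B_ge0)// invr_gt0//.
Qed.

End Subcritical.

Section Critical.
Variable M : R.
Hypotheses (a1 : a = 1) (r_fact2 : series (fun i => 'C(i, 2)%:R * r i) @ \oo --> M).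

Let r_mean1 : series (fun i => i%:R * r i) @ \oo --> (1 : R).
Proof. by move: r_mean; rewrite a1. Qed.
Let M0 : 0 < M. Proof. exact: (critical_drift_gt0 r_ge0 (r_gt0 0%N) r_sum r_mean1 r_fact2). Qed.

Lemma loss_critical : n%:R * p n @[n --> \oo] --> M.
Proof.
have [K K0 hK] := loss_inv_sub_takacs_bounded hA mean_neq0 mu0 hm r_mean1.
rewrite -cvg_shiftS.
have -> : (fun n => n.+1%:R * p n.+1) = (fun n => (l n / n.+1%:R)^-1).
  by apply/funext => n; rewrite pE invfM invrK mulrC.
rewrite -[M]invrK; apply: cvgV; first by rewrite invr_eq0 lt0r_neq0.
have vM := takacs_critical_cvg r_ge0 (r_gt0 0%N) r_sum r_mean1 r_fact2.
have d0 : (fun n => (l n - v n) / n.+1%:R) @ \oo --> (0 : R).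
  have h0 : (fun n => K * n.+1%:R^-1) @ \oo --> (0 : R).
    by rewrite -[0](mulr0 K); apply: cvgM; [exact: cvg_cst|exact: cvg_harmonic].
  apply/norm_cvg0P; apply: (squeeze_cvgr _ (cvg_cst 0) h0); near=> n.
  by rewrite normr_ge0/= normrM [`|_^-1|]gtr0_norm ?invr_gt0// ler_wpM2r.
have -> : (fun n => l n / n.+1%:R) = (fun n => v n / n.+1%:R + (l n - v n) / n.+1%:R).
  by apply/funext => n; rewrite -mulrDl addrC subrK.
by rewrite -[M^-1]addr0; apply: cvgD.
Unshelve. all: by end_near. Qed.

Lemma loss_critical_rate M3 :
  series (fun i => 'C(i, 3)%:R * r i) @ \oo --> (M3 : R) ->
  exists2 K : R, 0 < K & \forall n \near \oo, `|p n - M / n%:R| <= K / n%:R ^+ 2.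
Proof.
move=> r_fact3.
have [K K0 hK] := loss_inv_sub_takacs_bounded hA mean_neq0 mu0 hm r_mean1.
have hv := takacs_critical_bounded r_ge0 (r_gt0 0%N) r_sum r_mean1 r_fact2 r_fact3.
pose K3 := (r 0%N)^-1 * M3 + M * K.
have hl n : `|M * l n - n.+1%:R| <= K3.
  have -> : M * l n - n.+1%:R = (M * v n - n.+1%:R) + M * (l n - v n) by ring.
  rewrite (le_trans (ler_normD _ _))// lerD//.
  by rewrite normrM gtr0_norm// ler_wpM2l// ltW.
have K30 : 0 < K3.
  rewrite ltr_wpDl ?mulr_gt0//.
  exact: le_trans (normr_ge0 _) (hv 0%N).
exists (2 * M * K3); first by rewrite !mulr_gt0.
(* From this n on, M * l n is at least half of n + 1. *)
suff bound n : 2 * K3 <= n.+1%:R -> `|p n.+1 - M / n.+1%:R| <= 2 * M * K3 / n.+1%:R ^+ 2.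
  near=> n.
  have n0 : (0 < n)%N by near: n; exact: nbhs_infty_gt.
  rewrite -(prednK n0); apply: bound; rewrite prednK//.
  by near: n; exact: nbhs_infty_ger.
move=> nK; have nR : 0 < n.+1%:R :> R by rewrite ltr0n.
have Ml : n.+1%:R / 2 <= M * l n.
  have := hl n; rewrite ler_norml => /andP[h _]; lra.
have l0 : 0 < l n by rewrite -(pmulr_rgt0 _ M0) (lt_le_trans _ Ml)// divr_gt0.
have -> : p n.+1 - M / n.+1%:R = - (M * l n - n.+1%:R) / (n.+1%:R * l n).
  by rewrite pE; field; rewrite !lt0r_neq0.
rewrite normrM normrN [`|_^-1|]gtr0_norm ?invr_gt0 ?mulr_gt0//.
apply: (@le_trans _ _ (K3 / (n.+1%:R * l n))).
  by rewrite ler_wpM2r// invr_ge0 mulr_ge0// ltW.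
rewrite ler_pdivlMr ?exprn_gt0// mulrAC ler_pdivrMr ?mulr_gt0//.
have -> : K3 * n.+1%:R ^+ 2 = (2 * K3 * n.+1%:R) * (n.+1%:R / 2) by field.
have -> : 2 * M * K3 * (n.+1%:R * l n) = (2 * K3 * n.+1%:R) * (M * l n) by ring.
by rewrite ler_wpM2l// !mulr_ge0// ltW.
Unshelve. all: by end_near. Qed.

End Critical.

End LossLimits.

Theorem theorem3p1 (R : realType) (m : nat) (mu lambda : R)
    (A : cumulativeBounded (0 : R) (1 : R)) (p : nat -> R)
    (hm : (1 <= m)%N) (hmu : 0 < mu) (hlambda : 0 < lambda)
    (hA : nonneg_cdf A)
    (hmean : intA A (fun x => x) = (lambda^-1)%:E)
    (hp : forall n : nat, is_loss_probability A mu m n (p n)) :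
  [/\ 1 < load lambda mu m ->
        p n @[n --> \oo] --> (load lambda mu m - 1) / load lambda mu m,
      load lambda mu m = 1 -> (rho_ A mu m 2 < +oo)%E ->
        n%:R * p n @[n --> \oo] --> fine (rho_ A mu m 2) / 2,
      load lambda mu m = 1 -> (rho_ A mu m 3 < +oo)%E ->
        (fun n : nat => p n - fine (rho_ A mu m 2) / (2 * n%:R))
          =O_\oo (fun n : nat => ln n%:R / n%:R ^+ 2 : R)
    & load lambda mu m < 1 ->
        forall sigma : R, least_abs_root A mu m sigma ->
        p n / sigma ^+ n @[n --> \oo] -->
          K_ A mu m sigma *
          (1 + mu * m%:R *
             derive1 (alpha A) (mu * m%:R - mu * m%:R * sigma))].
Proof.
have y0 : 0 < mu * m%:R by rewrite mulr_gt0// ltr0n.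
have aE := load_inv mu lambda m.
have a0 : 0 < mu * m%:R / lambda by rewrite divr_gt0.
have a1 : load lambda mu m = 1 -> mu * m%:R / lambda = 1.
  by rewrite aE => /(congr1 (@GRing.inv R)); rewrite invrK invr1.
have fact k : (rho_ A mu m k < +oo)%E ->
    series (fun i => 'C(i, k)%:R * arrival_law A (mu * m%:R) i) @ \oo -->
    fine (rho_ A mu m k) / k`!%:R.
  move=> hk; apply: arrival_law_factorial_moment => //.
  rewrite -/(rho_ A mu m k) fineK// ge0_fin_numE//; apply: integral_ge0 => x /=.
  by rewrite in_itv/= andbT => x0; rewrite lee_fin exprn_ge0// mulr_ge0// ltW.
split.
- exact: (loss_overloaded hA hmu hlambda hm hmean hp).
- move=> /a1 h1 /fact h2.
  exact: (loss_critical hA hmu hlambda hm hmean hp h1 h2).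
- move=> /a1 h1 h3.
  have h2 := fact 2%N (moment2_lty hmu h3).
  have [K K0 hK] := loss_critical_rate hA hmu hlambda hm hmean hp h1 h2 (fact 3%N h3).
  apply/eqO_exP; exists K => //; near=> n.
  (* From here on ln n is at least 1. *)
  have ne : expR 1 <= n%:R :> R by near: n; exact: nbhs_infty_ger.
  have n0 : 0 < n%:R :> R by exact: lt_le_trans (expR_gt0 1) ne.
  have ln1 : 1 <= ln (n%:R : R) by rewrite -[leLHS]expRK ler_ln ?posrE ?expR_gt0.
  have hn : `|p n - fine (rho_ A mu m 2) / 2`!%:R / n%:R| <= K / n%:R ^+ 2.
    by near: n.
  rewrite /= invfM mulrA; apply: (le_trans hn); rewrite ler_wpM2l ?(ltW K0)//.
  rewrite ger0_norm ?mulr_ge0 ?invr_ge0 ?exprn_ge0 ?(ltW n0)//; last exact: le_trans ln1.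
  by rewrite ler_peMl// invr_ge0 exprn_ge0// ltW.
- move=> hl sigma hs.
  apply: (loss_underloaded hA hmu hlambda hm hmean hp _ hs).
  by rewrite -(invrK (_ / lambda)) -aE invf_gt1// aE invr_gt0.
Unshelve. all: by end_near. Qed.
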